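(* Let $n$ be a positive integer, let $\Theta\in(-n\frac{\pi}{2},n\frac{\pi}{2})$ be a constant, and let $u\in C^\infty(B_2(0))$, $B_2(0)\subset\mathbb{R}^n$, be a convex function solving the special Lagrangian equation $$\sum_{i=1}^n\arctan\lambda_i(D^2u(x))=\Theta\qquad\text{for all }x\in B_2(0).$$ Put $a(D^2u)=V^{1/n}$, where $V=\sqrt{\det(I+(D^2u)^2)}$. Then for any $y\in B_{1/2}(0)$ there exists a small enough $R=R(n,\|u\|_{C^{0,1}(B_1(0))})>0$ such that for any $0<r\le R$, $$\sup_{B_R(y)}a(D^2u)\le C\big(r,n,\|u\|_{C^{0,1}(B_1(0))}\big)\sup_{B_r(y)}a(D^2u),$$ and moreover $$\sup_{B_R(y)}|D^2u|\le C\Big(r,n,\|u\|_{C^{0,1}(B_1(0))},\sup_{B_r(y)}|D^2u|\Big).$$ Here $R$ and the two constants $C$ (which may differ) depend only on the indicated quantities.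
   Context: $B_r(p)$ denotes the open Euclidean ball of radius $r$ centred at $p$ in $\mathbb{R}^n$. $\lambda_1(M),\dots,\lambda_n(M)$ denote the eigenvalues, with multiplicity, of a real symmetric matrix $M$. $D^2u$ is the Hessian matrix of $u$, and $I$ is the identity matrix. $\|u\|_{C^{0,1}(B_1(0))}$ is the usual Lipschitz norm, i.e. $\sup_{B_1(0)}|u|$ plus the Lipschitz constant of $u$ on $B_1(0)$. *)

(* Defs.v *)
From HB Require Import structures.
From mathcomp Require Import all_boot all_order all_algebra.
From mathcomp Require Import all_classical all_reals all_analysis.

Set Implicit Arguments.
Unset Strict Implicit.
Unset Printing Implicit Defensive.

Import Order.TTheory GRing.Theory Num.Theory.
Import numFieldNormedType.Exports.

Local Open Scope classical_set_scope.
Local Open Scope ring_scope.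

Section Euclidean.
Context {R : realType} {n : nat}.
Implicit Types (x y : 'rV[R]_n) (A : 'M[R]_n) (f u : 'rV[R]_n -> R).

(* The library norm on 'rV_n is the sup norm, hence an explicit Euclidean one;
   both induce the same topology and the same partial derivatives. *)
Definition enorm x : R := Num.sqrt (\sum_(i < n) x ord0 i ^+ 2).

Definition eball x (r : R) : set 'rV[R]_n := [set y | enorm (y - x) < r].

Definition pderiv (i : 'I_n) f : 'rV[R]_n -> R :=
  fun x => 'D_(delta_mx ord0 i) f x.

(* iter_pderiv [:: i1; ...; ik] f is the derivative of f along e_ik first,
   ..., e_i1 last. *)
Definition iter_pderiv (s : seq 'I_n) f : 'rV[R]_n -> R := foldr pderiv f s.

(* C^oo on an open set U: all partial derivatives of all orders exist and are
   continuous on U.  Values of f outside U are irrelevant. *)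
Definition smooth_on (U : set 'rV[R]_n) f : Prop :=
  forall (s : seq 'I_n) x, U x ->
    {for x, continuous (iter_pderiv s f)} /\
    forall i : 'I_n, derivable (iter_pderiv s f) x (delta_mx ord0 i).

Definition hessian f x : 'M[R]_n :=
  \matrix_(i < n, j < n) pderiv i (pderiv j f) x.

(* lam lists the eigenvalues of A with algebraic multiplicity. Such a lam
   exists for every real symmetric A and is unique up to reordering. *)
Definition is_eigenvalues A (lam : 'I_n -> R) : Prop :=
  char_poly A = \prod_(i < n) ('X - (lam i)%:P).

Definition special_lagrangian (U : set 'rV[R]_n) (Theta : R) u : Prop :=
  forall x, U x -> exists lam : 'I_n -> R,
    is_eigenvalues (hessian u x) lam /\ \sum_(i < n) atan (lam i) = Theta.

Definition slag_V A : R := Num.sqrt (\det (1%:M + A *m A)).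

Definition slag_a A : R := slag_V A `^ n%:R^-1.

(* Frobenius norm. *)
Definition mxnorm A : R := Num.sqrt (\sum_(i < n) \sum_(j < n) A i j ^+ 2).

Definition sup_on (U : set 'rV[R]_n) f : \bar R :=
  ereal_sup [set (f x)%:E | x in U].

Definition lipschitz_seminorm (U : set 'rV[R]_n) f : \bar R :=
  ereal_sup [set (`|f p.1 - f p.2| / enorm (p.1 - p.2))%:E |
             p in [set p | U p.1 /\ U p.2 /\ p.1 <> p.2]].

Definition C01_norm (U : set 'rV[R]_n) f : \bar R :=
  (sup_on U (fun x => `|f x|%R) + lipschitz_seminorm U f)%E.

End Euclidean.

(* Main.v *)
Require Import Defs.
From mathcomp Require Import all_boot all_order all_algebra.
From mathcomp Require Import all_classical all_reals all_analysis.
From mathcomp Require Import perm complex ring lra.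

(** The statement is a maximum principle on the gradient graph of u. Write H for
    the Hessian of u at a point, l_1, ..., l_n for its eigenvalues, which are
    nonnegative by convexity, and g_k = 1 / (1 + l_k^2). Let L be the operator
    summing g_k times the second derivative along the k-th eigenvector.

    The equation says that det(1 + i H) = V exp(i Theta) (slag_phase).
    Expanding this identity to second order along the eigenvectors
    (phase_jets), the first-order imaginary part says that every partial
    derivative of u is annihilated by L, as are the coordinates. The
    second-order part gives L log V in terms of third derivatives of u, and for
    convex u it yields the Jacobi inequality |grad log V|^2 <= n L log V
    (jacobi_inequality), where the gradient is measured with the weights g_k.
    Equivalently the positive function V^(-1/n) = 1 / a is a supersolution.

    A supersolution is propagated from B_r(y) by a barrier. For a slope K let
    s(x) = |K (x - y) + Du(x) - Du(y)|^2. Since x and Du are annihilated by L,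
    L s involves no third derivatives: it is at most 2 n (K^2 + 1), and the
    squared gradient of s is at least 4 s, however large the Hessian is. Hence
    exp(- kap s) is a strict subsolution where s is bounded below, for kap
    large (barrier_subsolution). Monotonicity of Du gives s >= K^2 |x - y|^2
    (twist_lower), so s is bounded below outside B_r(y) and is large on the
    sphere of radius 1/4 around y; the gradient bound |D_i u| <= N on the unit
    ball (gradient_bound) gives s <= n (1 + 2 N)^2 on the ball of radius
    R = 1 / K (twist_upper). With K large in terms of n and N, the barrier
    h = exp(- kap s) - const is nonpositive on the sphere of radius 1/4 and at
    least a positive constant on B_R(y).

    For odd M >= n, the maximum of V h^M over the closed ball of radius 1/4 is
    therefore interior, and the Jacobi inequality forbids it to lie outside
    B_r(y) (no_interior_max). Evaluating V h^M at the maximum gives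
    V <= C V(x1) on B_R(y) with x1 in B_r(y) and C depending on r, n and N only
    (slag_V_doubling). The bound for a follows by taking the power 1/n, and the
    bound for the Hessian because V lies between the Frobenius norm of H and a
    power of 1 + |H|^2 (slag_V_bounds). *)

Set Implicit Arguments.
Unset Strict Implicit.
Unset Printing Implicit Defensive.

Import Order.TTheory GRing.Theory Num.Theory.
Import numFieldNormedType.Exports.

Local Open Scope classical_set_scope.
Local Open Scope ring_scope.

(** * Second-order expansions of real functions *)

Section Jets.
Variable R : realType.
Implicit Types (f g : R -> R) (a b c : R).

(** Only the values of second-order Taylor expansions enter the maximum
    principle, so differentiability is replaced by an expansion with an error
    that is little-o of t^2 at 0. Such expansions multiply and compose like
    truncated polynomials, and no derivative of a determinant or of an
    exponential has to be computed. The last entry is half a second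
    derivative. *)
Definition jet f a b c := forall e : R, 0 < e ->
  \forall t \near (0 : R), `|f t - (a + b * t + c * t ^+ 2)| <= e * t ^+ 2.

Lemma near0_norm_lt (d : R) : 0 < d -> \forall t \near (0 : R), `|t| < d.
Proof.
move=> d0; exists d => //= t; by rewrite /= sub0r normrN.
Qed.

Lemma jet_ext f g a b c : (\forall t \near (0 : R), f t = g t) ->
  jet f a b c -> jet g a b c.
Proof.
move=> fg jf e e0; near=> t.
have <- : f t = g t by near: t.
by near: t; exact: jf.
Unshelve. all: by end_near. Qed.

Lemma jet_eq f a b c a' b' c' : jet f a b c ->
  a = a' -> b = b' -> c = c' -> jet f a' b' c'.
Proof. by move=> j <- <- <-. Qed.

Lemma jet_poly a b c : jet (fun t => a + b * t + c * t ^+ 2) a b c.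
Proof.
by move=> e e0; near=> t; rewrite subrr normr0 mulr_ge0 ?sqr_ge0 // ltW.
Unshelve. all: by end_near. Qed.

Lemma jet_cst a : jet (fun=> a) a 0 0.
Proof.
by move=> e e0; near=> t; rewrite !mul0r !addr0 subrr normr0 mulr_ge0 ?sqr_ge0 // ltW.
Unshelve. all: by end_near. Qed.

Lemma jet_id : jet id 0 1 0.
Proof.
by move=> e e0; near=> t; rewrite mul0r mul1r addr0 add0r subrr normr0 mulr_ge0 ?sqr_ge0 // ltW.
Unshelve. all: by end_near. Qed.

Lemma jetD f g a b c a' b' c' : jet f a b c -> jet g a' b' c' ->
  jet (fun t => f t + g t) (a + a') (b + b') (c + c').
Proof.
move=> jf jg e e0; have e20 : 0 < e / 2 by lra.
near=> t.
have h1 : `|f t - (a + b * t + c * t ^+ 2)| <= e / 2 * t ^+ 2 by near: t; exact: jf.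
have h2 : `|g t - (a' + b' * t + c' * t ^+ 2)| <= e / 2 * t ^+ 2.
  by near: t; exact: jg.
have -> : f t + g t - (a + a' + (b + b') * t + (c + c') * t ^+ 2) =
  (f t - (a + b * t + c * t ^+ 2)) + (g t - (a' + b' * t + c' * t ^+ 2)) by ring.
apply: (le_trans (ler_normD _ _)); apply: (le_trans (lerD h1 h2)).
by rewrite -mulrDl -splitr.
Unshelve. all: by end_near. Qed.

(** With f = p + A and g = q + B, the error is A q + p B + A B plus the terms of
    p q of degree three and four; near 0 the polynomials p and q are bounded and
    the extra terms carry a spare factor t. *)
Lemma jetM f g a b c a' b' c' : jet f a b c -> jet g a' b' c' ->
  jet (fun t => f t * g t) (a * a') (a * b' + b * a')
    (a * c' + b * b' + c * a').
Proof.
move=> jf jg e e0.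
pose P := `|a| + `|b| + `|c| + 1; pose Q := `|a'| + `|b'| + `|c'| + 1.
pose T := `|b * c'| + `|c * b'| + `|c * c'| + 1.
have P0 : 0 < P by rewrite /P ltr_wpDl ?addr_ge0.
have Q0 : 0 < Q by rewrite /Q ltr_wpDl ?addr_ge0.
have T0 : 0 < T by rewrite /T ltr_wpDl ?addr_ge0.
pose e1 := Num.min 1 (e / (2 * (P + Q + 1))).
have S0 : 0 < 2 * (P + Q + 1) by lra.
have e10 : 0 < e1 by rewrite /e1 lt_min ltr01 divr_gt0.
have le1 : e1 <= 1 by rewrite /e1 ge_min lexx.
have le2 : e1 * (P + Q + 1) <= e / 2.
  apply: (@le_trans _ _ (e / (2 * (P + Q + 1)) * (P + Q + 1))).
    by rewrite ler_wpM2r /e1 ?ge_min ?lexx ?orbT//; lra.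
  by rewrite invfM mulrA divfK // gt_eqF //; lra.
have dT : 0 < e / (2 * T) by rewrite divr_gt0 // mulr_gt0.
near=> t.
have h1 : `|f t - (a + b * t + c * t ^+ 2)| <= e1 * t ^+ 2 by near: t; exact: jf.
have h2 : `|g t - (a' + b' * t + c' * t ^+ 2)| <= e1 * t ^+ 2.
  by near: t; exact: jg.
have t1 : `|t| < 1 by near: t; exact: near0_norm_lt.
have tT : `|t| < e / (2 * T) by near: t; exact: near0_norm_lt.
have poly_le (x y z : R) : `|x + y * t + z * t ^+ 2| <= `|x| + `|y| + `|z| + 1.
  have -> : `|x| + `|y| + `|z| + 1 = `|x| + `|y| * 1 + `|z| * 1 + 1 by ring.
  rewrite -[leLHS]addr0 lerD //.
  apply: (le_trans (ler_normD _ _)); apply: lerD.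
    apply: (le_trans (ler_normD _ _)); apply: lerD => //.
    by rewrite normrM ler_wpM2l // ltW.
  by rewrite normrM ler_wpM2l // normrX exprn_ile1 // ltW.
set A := f t - _ in h1; set B := g t - _ in h2.
set p := a + b * t + c * t ^+ 2 in A h1; set q := a' + b' * t + c' * t ^+ 2 in B h2.
have pP : `|p| <= P by exact: poly_le.
have qQ : `|q| <= Q by exact: poly_le.
have t20 : 0 <= t ^+ 2 by exact: sqr_ge0.
have t2l : t ^+ 2 <= 1 by rewrite -real_normK ?num_real // exprn_ile1 // ltW.
have -> : f t * g t - (a * a' + (a * b' + b * a') * t + (a * c' + b * b' + c * a') * t ^+ 2)
  = (A * q + p * B + A * B) + (b * c' * t + c * b' * t + c * c' * t * t) * t ^+ 2.
  rewrite /A /B /p /q; ring.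
have E1 : `|A * q + p * B + A * B| <= e / 2 * t ^+ 2.
  apply: (@le_trans _ _ (e1 * (P + Q + 1) * t ^+ 2)); last by rewrite ler_wpM2r.
  have -> : e1 * (P + Q + 1) * t ^+ 2 = e1 * t ^+ 2 * Q + P * (e1 * t ^+ 2) + e1 * t ^+ 2 * 1
    by ring.
  apply: (le_trans (ler_normD _ _)); apply: lerD.
    apply: (le_trans (ler_normD _ _)); apply: lerD; rewrite normrM ler_pM //.
  rewrite normrM ler_pM // (le_trans h2) // mulr_ile1 // ltW //.
have E2 : `|b * c' * t + c * b' * t + c * c' * t * t| <= e / 2.
  apply: (@le_trans _ _ (T * `|t|)).
    rewrite /T; rewrite 3!mulrDl mul1r -[leLHS]addr0 lerD //.
    apply: (le_trans (ler_normD _ _)); apply: lerD.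
      by apply: (le_trans (ler_normD _ _)); apply: lerD; rewrite normrM.
    rewrite normrM [`|_ * t|]normrM -[leRHS]mulr1 ler_pM ?mulr_ge0 //; exact: ltW.
  rewrite mulrC -ler_pdivlMr // (le_trans (ltW tT)) // invfM mulrA //.
apply: (le_trans (ler_normD _ _)).
rewrite [leRHS](_ : _ = e / 2 * t ^+ 2 + e / 2 * t ^+ 2); last by lra.
by apply: lerD => //; rewrite normrM [`|t ^+ 2|]ger0_norm // ler_wpM2r.
Unshelve. all: by end_near. Qed.

Lemma jetN f a b c : jet f a b c -> jet (fun t => - f t) (- a) (- b) (- c).
Proof.
move=> jf; have := jetM (jet_cst (-1)) jf.
rewrite !mul0r !addr0 !mulN1r; apply: jet_ext.
by near=> t; rewrite mulN1r.
Unshelve. all: by end_near. Qed.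

Lemma jet_opp : jet (fun t => - t) 0 (-1) 0.
Proof. by have := jetN jet_id; rewrite oppr0. Qed.

Lemma jetB f g a b c a' b' c' : jet f a b c -> jet g a' b' c' ->
  jet (fun t => f t - g t) (a - a') (b - b') (c - c').
Proof. by move=> jf jg; apply: jetD => //; exact: jetN. Qed.

Lemma jet_sum (I : Type) (r : seq I) (F : I -> R -> R) (a b c : I -> R) :
  (forall i, jet (F i) (a i) (b i) (c i)) ->
  jet (fun t => \sum_(i <- r) F i t)
    (\sum_(i <- r) a i) (\sum_(i <- r) b i) (\sum_(i <- r) c i).
Proof.
move=> jF; elim: r => [|i r IH].
  by rewrite !big_nil; apply: jet_ext (jet_cst 0); near=> t; rewrite big_nil.
rewrite !big_cons; apply: jet_ext (jetD (jF i) IH).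
by near=> t; rewrite big_cons.
Unshelve. all: by end_near. Qed.

(** First- and second-derivative tests at an interior maximum. *)
Lemma jet_max f a b c : jet f a b c ->
  (\forall t \near (0 : R), f t <= a) -> b = 0 /\ c <= 0.
Proof.
move=> jf fa.
have b0 : b = 0.
  apply/eqP/negPn/negP => bn0.
  have b0 : 0 < `|b| by rewrite normr_gt0.
  pose C := `|c| + 1; have C0 : 0 < C by rewrite /C ltr_wpDl.
  have [d /= d0 hd] : \forall t \near (0 : R), b * t <= C * t ^+ 2.
    near=> t.
    have h1 : `|f t - (a + b * t + c * t ^+ 2)| <= 1 * t ^+ 2 by near: t; exact: jf.
    have h2 : f t <= a by near: t.
    have : c * t ^+ 2 >= - (`|c| * t ^+ 2).
      rewrite -mulNr ler_wpM2r ?sqr_ge0 // lerNl -normrN; exact: ler_norm.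
    rewrite /C mulrDl; move: h1; rewrite ler_norml => /andP[]; lra.
  pose s := Num.min (d / 2) (`|b| / (2 * C)).
  have s0 : 0 < s by rewrite lt_min !divr_gt0 // mulr_gt0.
  have sd : s < d by rewrite (@le_lt_trans _ _ (d / 2)) ?ge_min ?lexx //; lra.
  have sb : s * C <= `|b| / 2.
    apply: (@le_trans _ _ (`|b| / (2 * C) * C)).
      by rewrite ler_wpM2r ?ge_min ?lexx ?orbT // ltW.
    by rewrite invfM mulrA divfK // gt_eqF.
  have := hd (Num.sg b * s).
  rewrite /= sub0r normrN normrM normr_sg bn0 mul1r gtr0_norm // => /(_ sd).
  rewrite mulrA [b * _]mulrC -normrEsg exprMn sqr_sg bn0 mul1r => hh.
  have : `|b| * s <= `|b| / 2 * s by apply: (le_trans hh); rewrite expr2 mulrA ler_wpM2r 1?mulrC // ltW.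
  rewrite ler_pM2r //; lra.
split=> //; rewrite leNgt; apply/negP => c0.
have c20 : 0 < c / 2 by lra.
have [d /= d0 hd] : \forall t \near (0 : R), c / 2 * t ^+ 2 <= 0.
  near=> t.
  have h1 : `|f t - (a + b * t + c * t ^+ 2)| <= c / 2 * t ^+ 2 by near: t; exact: jf.
  have h2 : f t <= a by near: t.
  by move: h1; rewrite b0 mul0r addr0 ler_norml => /andP[]; lra.
have := hd (d / 2); rewrite /= sub0r normrN gtr0_norm ?divr_gt0 //.
have -> : d / 2 < d by lra.
move=> /(_ isT); rewrite leNgt; have -> // : 0 < c / 2 * (d / 2) ^+ 2.
by rewrite mulr_gt0 // exprn_gt0 // divr_gt0.
Unshelve. all: by end_near. Qed.

Lemma jet_at0 f a b c : jet f a b c -> f 0 = a.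
Proof.
move=> /(_ 1 ltr01) /nbhs_singleton.
by rewrite expr0n /= !mulr0 !addr0 normr_le0 subr_eq0 => /eqP.
Qed.

(** The difference of two expansions of f is an expansion of 0, to which the
    derivative tests apply with both signs. This turns an identity between
    functions into identities between coefficients. *)
Lemma jet_uniq f a b c a' b' c' : jet f a b c -> jet f a' b' c' ->
  [/\ a = a', b = b' & c = c'].
Proof.
move=> j1 j2.
have j0 := jetB j1 j2.
have aa : a = a' by rewrite -(jet_at0 j1) (jet_at0 j2).
have [] := jet_max j0; first by near=> t; rewrite subrr aa subrr.
move=> /eqP; rewrite subr_eq0 => /eqP bb; rewrite subr_le0 => cc.
have [] := jet_max (jetB j2 j1); first by near=> t; rewrite subrr aa subrr.
rewrite subr_le0 => _ cc'; split => //; apply/eqP; by rewrite eq_le cc cc'.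
Unshelve. all: by end_near. Qed.

End Jets.

(** * Derivatives along lines and Taylor expansions *)

Section Directional.
Variables (R : realType).

(** A multiplicative form of differentiability, free of difference quotients
    and of the punctured neighbourhood. *)
Lemma is_deriveP (V : normedModType R) (f : V -> R) (x v : V) (d : R) :
  is_derive x v f d <->
  (forall e : R, 0 < e ->
     \forall h \near (0 : R), `|f (x + h *: v) - f x - h * d| <= e * `|h|).
Proof.
split=> [[df dfE] e e0|H].
  have /cvgrPdist_le /(_ _ e0) := df; rewrite -/('D_v f x) dfE /= => -[r /= r0 hr].
  exists r => // h /=; rewrite sub0r normrN => hlt.
  have [->|hn0] := eqVneq h 0.
    by rewrite scale0r addr0 subrr mul0r subr0 normr0 mulr0.
  have := hr h; rewrite /= sub0r normrN => /(_ hlt hn0) hh.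
  have -> : f (x + h *: v) - f x - h * d = - (h * (d - h^-1 *: (f (h *: v + x) - f x))).
    by rewrite mulrBr [_^-1 *: _]/(_ * _) mulrA divff // mul1r opprB [h *: v + x]addrC.
  by rewrite normrN normrM mulrC ler_wpM2r.
have C : (fun h => h^-1 *: (f (h *: v + x) - f x)) @ 0^' --> d.
  apply/cvgrPdist_le => e e0; have [r /= r0 hr] := H e e0.
  exists r => // h /=; rewrite sub0r normrN => hlt hn0.
  have := hr h; rewrite /= sub0r normrN => /(_ hlt).
  have -> : d - h^-1 *: (f (h *: v + x) - f x) = - (h^-1 * (f (x + h *: v) - f x - h * d)).
    by rewrite mulrBr mulrA mulVf // mul1r opprB [h *: v + x]addrC.
  rewrite normrN normrM normfV => hh.
  by rewrite mulrC ler_pdivrMr ?normr_gt0.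
apply: DeriveDef; first by apply/cvg_ex; exists d.
exact: cvg_lim C.
Qed.

Lemma is_derive_line (V : normedModType R) (f : V -> R) (x v : V) (t d : R) :
  is_derive (x + t *: v) v f d -> is_derive t 1 (fun s : R => f (x + s *: v)) d.
Proof.
move=> /is_deriveP H; apply/is_deriveP => e /H.
apply: filterS => h.
have -> : h *: (1 : R) = h by rewrite [LHS]mulr1.
by rewrite scalerDl addrA.
Qed.

Lemma mvt_from0 (f df : R -> R) (t : R) :
  (forall s : R, `|s| <= `|t| -> is_derive s 1 f (df s)) ->
  exists2 c, `|c| <= `|t| & f t - f 0 = t * df c.
Proof.
move=> H.
have cont (a b : R) : (forall s, a <= s <= b -> `|s| <= `|t|) -> {within `[a, b], continuous f}.
  move=> hab; apply/continuous_in_subspaceT => s; rewrite inE /= in_itv /= => sab.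
  have := H s (hab s sab) => - [ds _].
  by apply: differentiable_continuous; apply/derivable1_diffP.
have [t0|t0|->] := ltgtP t 0.
- have hab s : t <= s <= 0 -> `|s| <= `|t|.
    by move=> /andP[h1 h2]; rewrite !ler0_norm // ?lerN2 // ltW.
  have [|c ci hc] := MVT t0 (df := df) _ (cont _ _ hab).
    move=> s /[!in_itv] /= /andP[/ltW h1 /ltW h2]; apply: H; apply: hab.
    by rewrite h1.
  exists c; first by apply: hab; move: ci; rewrite in_itv /= => /andP[/ltW -> /ltW ->].
  by move: hc => /(congr1 -%R); rewrite opprB => ->; ring.
- have hab s : 0 <= s <= t -> `|s| <= `|t|.
    by move=> /andP[h1 h2]; rewrite !ger0_norm // ltW.
  have [|c ci hc] := MVT t0 (df := df) _ (cont _ _ hab).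
    move=> s /[!in_itv] /= /andP[/ltW h1 /ltW h2]; apply: H; apply: hab.
    by rewrite h1.
  exists c; first by apply: hab; move: ci; rewrite in_itv /= => /andP[/ltW -> /ltW ->].
  by rewrite hc subr0 mulrC.
- by exists 0 => //; rewrite subrr mul0r.
Qed.

(** Taylor's formula with Peano remainder: the remainder g has derivative
    df(s) - df(0) - s d2 = o(s), and the mean value theorem integrates this to
    o(t^2). *)
Lemma jet_taylor (f df : R -> R) (d2 : R) :
  (\forall t \near (0 : R), is_derive (t : R) 1 f (df t)) -> is_derive (0 : R) 1 df d2 ->
  jet f (f 0) (df 0) (d2 / 2).
Proof.
move=> [r1 /= r10 H1] /is_deriveP H2 e e0.
have [r2 /= r20 {}H2] := H2 e e0.
exists (Num.min r1 r2); first by rewrite /= lt_min r10.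
move=> t /=; rewrite sub0r normrN lt_min => /andP[t1 t2].
pose g s := f s - (f 0 + df 0 * s + d2 / 2 * s ^+ 2).
pose dg s := df s - (df 0 + d2 * s).
have [|c ct hc] := @mvt_from0 g dg t.
  move=> s st.
  have hf : is_derive s 1 f (df s).
    by apply: H1 => /=; rewrite sub0r normrN (le_lt_trans st).
  rewrite /g; apply: is_derive_eq.
  have sc (a b : R) : a *: b = a * b by [].
  by rewrite /dg !sc; field.
have -> : f t - (f 0 + df 0 * t + d2 / 2 * t ^+ 2) = g t - g 0.
  by rewrite /g expr0n /= !mulr0; ring.
rewrite hc normrM mulrC -(real_normK (num_real t)) expr2 mulrA ler_wpM2r //.
have := H2 c; rewrite /= sub0r normrN (le_lt_trans ct) // => /(_ isT).
have -> : c *: (1 : R) = c by rewrite [LHS]mulr1.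
rewrite add0r /dg => h.
rewrite (_ : _ - _ = df c - df 0 - c * d2); last by ring.
by apply: (le_trans h); rewrite ler_wpM2l // ltW.
Qed.

Lemma jet_comp0 (g f : R -> R) g0 g1 g2 b c :
  jet g g0 g1 g2 -> jet f 0 b c ->
  jet (fun t => g (f t)) g0 (g1 * b) (g1 * c + g2 * b ^+ 2).
Proof.
move=> jg jf.
have jp := jetD (jetD (jet_cst g0) (jetM (jet_cst g1) jf))
  (jetM (jet_cst g2) (jetM jf jf)).
move=> e e0.
pose B := `|b| + `|c| + 1; have B0 : 0 < B by rewrite /B ltr_wpDl ?addr_ge0.
have e20 : 0 < e / 2 by lra.
have e10 : 0 < e / (2 * B ^+ 2) by rewrite divr_gt0 // mulr_gt0 ?exprn_gt0.
have [r /= r0 hr] := jg _ e10.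
have rB : 0 < r / B by rewrite divr_gt0.
near=> t.
have t1 : `|t| < 1 by near: t; exact: near0_norm_lt.
have tr : `|t| < r / B by near: t; exact: near0_norm_lt.
have fB : `|f t| <= B * `|t|.
  have h1 : `|f t - (0 + b * t + c * t ^+ 2)| <= 1 * t ^+ 2 by near: t; exact: jf.
  have -> : f t = (f t - (0 + b * t + c * t ^+ 2)) + (b + c * t) * t by ring.
  apply: (le_trans (ler_normD _ _)).
  rewrite [leLHS]addrC /B [leRHS]mulrDl lerD //.
    rewrite normrM ler_wpM2r //; apply: (le_trans (ler_normD _ _)).
    by rewrite lerD // normrM ler_piMr // ltW.
  apply: (le_trans h1); rewrite !mul1r -(real_normK (num_real t)).
  by rewrite expr2 ler_piMr // ltW.
have h2 : `|f t * f t| <= B ^+ 2 * t ^+ 2.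
  rewrite normrM -(real_normK (num_real t)) -exprMn expr2.
  by rewrite ler_pM.
have h1 : `|g (f t) - (g0 + g1 * f t + g2 * f t ^+ 2)| <= e / 2 * t ^+ 2.
  have := hr (f t); rewrite /= sub0r normrN => h.
  apply: (le_trans (h _)).
    by apply: (le_lt_trans fB); rewrite mulrC -ltr_pdivlMr.
  apply: (@le_trans _ _ (e / (2 * B ^+ 2) * (B ^+ 2 * t ^+ 2))).
    rewrite ler_wpM2l ?(ltW e10) //.
    by rewrite expr2 (le_trans (ler_norm _)).
  have Bn0 : B != 0 by rewrite gt_eqF.
  by rewrite le_eqVlt; apply/orP; left; apply/eqP; field.
have h3 : `|g0 + g1 * f t + g2 * (f t * f t) -
   (g0 + 0 + g1 * 0 + g2 * (0 * 0) +
    (0 + (g1 * b + 0 * 0) + (g2 * (0 * b + b * 0) + 0 * (0 * 0))) * t +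
    (0 + (g1 * c + 0 * b + 0 * 0) +
     (g2 * (0 * c + b * b + c * 0) + 0 * (0 * b + b * 0) + 0 * (0 * 0))) * t ^+ 2)|
   <= e / 2 * t ^+ 2.
  by near: t; have := jp _ e20; apply: filterS => s; congr (`|_ - _| <= _); ring.
rewrite (_ : _ - _ = (g (f t) - (g0 + g1 * f t + g2 * f t ^+ 2)) +
  (g0 + g1 * f t + g2 * (f t * f t) - (g0 + g1 * b * t + (g1 * c + g2 * b ^+ 2) * t ^+ 2)));
  last by ring.
apply: (le_trans (ler_normD _ _)).
rewrite [leRHS](_ : _ = e / 2 * t ^+ 2 + e / 2 * t ^+ 2); last by lra.
apply: lerD => //; apply: le_trans h3; rewrite le_eqVlt; apply/orP; left.
apply/eqP; congr (`|_|); ring.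
Unshelve. all: by end_near. Qed.

Lemma jet_expR (f : R -> R) a b c : jet f a b c ->
  jet (fun t => expR (f t)) (expR a) (expR a * b) (expR a * (c + b ^+ 2 / 2)).
Proof.
move=> jf.
have jf0 : jet (fun t => f t - a) 0 b c.
  have := jetB jf (jet_cst a); by rewrite subrr !subr0.
have je : jet (@expR R) 1 1 (1 / 2).
  have := @jet_taylor (@expR R) (@expR R) 1; rewrite expR0; apply.
    by near=> t; exact: is_derive_expR.
  by rewrite -[X in is_derive _ _ _ X](@expR0 R); exact: is_derive_expR.
have := jetM (jet_cst (expR a)) (jet_comp0 je jf0).
rewrite !mul1r !mul0r !addr0 mulr1 [2^-1 * _]mulrC.
apply: jet_ext; near=> t.
by rewrite -expRD addrC subrK.
Unshelve. all: by end_near. Qed.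

Lemma jetX (f : R -> R) (m : nat) e z :
  jet f 1 e z ->
  jet (fun t => f t ^+ m) 1 (m%:R * e) (m%:R * z + m%:R * (m%:R - 1) / 2 * e ^+ 2).
Proof.
move=> jf; elim: m => [|m IH].
  rewrite !mul0r addr0; apply: jet_ext (jet_cst 1).
  by near=> t; rewrite expr0.
have := jetM jf IH; rewrite mulr1.
have -> : 1 * (m%:R * e) + e * 1 = m.+1%:R * e by rewrite -natr1; ring.
have -> : 1 * (m%:R * z + m%:R * (m%:R - 1) / 2 * e ^+ 2) + e * (m%:R * e) + z * 1 =
  m.+1%:R * z + m.+1%:R * (m.+1%:R - 1) / 2 * e ^+ 2 by rewrite -natr1; field.
by apply: jet_ext; near=> t; rewrite exprS.
Unshelve. all: by end_near. Qed.

Lemma near_line (V : normedModType R) (P : V -> Prop) (x v : V) :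
  (\forall y \near x, P y) -> \forall t \near (0 : R), P (x + t *: v).
Proof.
move=> H.
have C : (fun t : R => x + t *: v) @ (0 : R) --> x.
  rewrite -[X in _ --> X]addr0 -(scale0r v).
  by apply: cvgD; [exact: cvg_cst | apply: cvgZr_tmp; exact: cvg_id].
exact: (C _ H).
Qed.

End Directional.

(** * Directional derivatives of smooth functions *)

Section Smooth.
Variables (R : realType).

(** The increment along w + c v is split into an increment along w from x and
    one along v from the moved point; the mean value theorem writes the second
    as a derivative along v at a point close to x, so continuity of that
    derivative suffices. Iterating over the basis vectors makes directional
    derivatives of smooth functions linear in the direction. *)
Lemma is_derive_add_dir (V : normedModType R) (f : V -> R) (x w v : V) (dw c : R) :
  is_derive x w f dw -> (\forall y \near x, derivable f y v) ->
  {for x, continuous ('D_v f)} ->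
  is_derive x (w + c *: v) f (dw + c * 'D_v f x).
Proof.
move=> /is_deriveP Hw Hd Hc; apply/is_deriveP => e e0.
pose C := `|c| + 1; have C0 : 0 < C by rewrite /C ltr_wpDl.
have e1 : 0 < e / 2 by lra.
have e2 : 0 < e / (2 * C) by rewrite divr_gt0 // mulr_gt0.
have /nbhs_ballP[r /= r0 hr] : \forall y \near x,
    derivable f y v /\ `|'D_v f x - 'D_v f y| < e / (2 * C).
  near=> y; split; first by near: y.
  by near: y; move/cvgrPdist_lt: Hc; exact.
pose W := `|w| + `|c| * `|v| + 1.
have W0 : 0 < W by rewrite /W ltr_wpDl // addr_ge0 // mulr_ge0.
near=> h.
have hW : `|h| * W < r.
  by rewrite -ltr_pdivlMr //; near: h; apply: near0_norm_lt; rewrite divr_gt0.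
have close s : `|s| <= `|h * c| ->
    derivable f (x + h *: w + s *: v) v /\
    `|'D_v f x - 'D_v f (x + h *: w + s *: v)| < e / (2 * C).
  move=> hs; apply: hr; rewrite -ball_normE /=.
  rewrite -addrA opprD addNKr normrN.
  apply: le_lt_trans hW; apply: (le_trans (ler_normD _ _)).
  rewrite /W mulrDr mulr1 -[leLHS]addr0 lerD // mulrDr !normrZ lerD //.
  by rewrite mulrA ler_wpM2r // -normrM.
have [|s hs hm] := @mvt_from0 _ (fun s => f (x + h *: w + s *: v))
   (fun s => 'D_v f (x + h *: w + s *: v)) (h * c).
  move=> s hs; apply: is_derive_line.
  by have [dv _] := close s hs; exact: derivableP.
have -> : f (x + h *: (w + c *: v)) - f x - h * (dw + c * 'D_v f x) =
   (f (x + h *: w) - f x - h * dw) +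
   h * c * ('D_v f (x + h *: w + s *: v) - 'D_v f x).
  move: hm; rewrite scale0r addr0 scalerDr scalerA addrA => hm.
  by rewrite mulrBr -hm; ring.
apply: (le_trans (ler_normD _ _)).
rewrite [leRHS](_ : _ = e / 2 * `|h| + e / 2 * `|h|); last by lra.
apply: lerD; first by near: h; exact: Hw.
have [_ /ltW cs] := close s hs.
rewrite normrM distrC normrM.
apply: (@le_trans _ _ (`|h| * C * (e / (2 * C)))).
  by apply: ler_pM => //; rewrite ?mulr_ge0 // ler_wpM2l // /C lerDl.
have Cn0 : C != 0 by rewrite gt_eqF.
by rewrite le_eqVlt; apply/orP; left; apply/eqP; field.
Unshelve. all: by end_near. Qed.

Lemma near_eq_continuous (V : normedModType R) (f g : V -> R) (x : V) (l : R) :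
  (\forall y \near x, f y = g y) -> f @ x --> l -> g @ x --> l.
Proof.
move=> fg; apply: cvg_trans; apply: near_eq_cvg.
by apply: filterS fg => y ->.
Qed.

Lemma cvg_lincomb (V : normedModType R) (I : finType) (a : I -> R)
    (F : I -> V -> R) (x : V) :
  (forall i, F i @ x --> F i x) ->
  (fun y => \sum_i a i * F i y) @ x --> \sum_i a i * F i x.
Proof.
move=> cF.
have HH r : (fun y => \sum_(i <- r) a i * F i y) @ x --> \sum_(i <- r) a i * F i x.
  elim: r => [|i r IHr].
    rewrite big_nil (_ : (fun _ => _) = cst 0); first exact: cvg_cst.
    by apply/funext => z; rewrite big_nil.
  rewrite big_cons (_ : (fun _ => _) = (fun y => a i * F i y +
      \sum_(i <- r) a i * F i y)); last first.
    by apply/funext => z; rewrite big_cons.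
  by apply: cvgD IHr; apply: cvgM; [exact: cvg_cst | exact: cF].
exact: HH.
Qed.

Lemma is_derive_lincomb (V : normedModType R) (I : finType) (a : I -> R)
    (F : I -> V -> R) (d : I -> R) (x v : V) :
  (forall i, is_derive x v (F i) (d i)) ->
  is_derive x v (fun y => \sum_i a i * F i y) (\sum_i a i * d i).
Proof.
move=> dF.
have HH r : is_derive x v (fun y => \sum_(i <- r) a i * F i y) (\sum_(i <- r) a i * d i).
  elim: r => [|i r IHr].
    rewrite big_nil (_ : (fun _ => _) = cst 0); first exact: is_derive_cst.
    by apply/funext => z; rewrite big_nil.
  rewrite big_cons (_ : (fun _ => _) = (a i *: F i) +
    (fun x => \sum_(i <- r) a i * F i x)); last first.
    by apply/funext => z; rewrite big_cons.
  by apply: is_deriveD; apply: is_deriveZ.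
exact: HH.
Qed.

Lemma is_derive_subfun (V : normedModType R) (f g : V -> R) (x v : V) (df dg : R) :
  is_derive x v f df -> is_derive x v g dg ->
  is_derive x v (fun y => f y - g y) (df - dg).
Proof. by move=> hf hg; have := is_deriveB hf hg. Qed.

Section OpenSet.
Variables (n : nat) (U : set 'rV[R]_n).
Hypothesis oU : open U.
Implicit Types (f g : 'rV[R]_n -> R) (x v w : 'rV[R]_n).

Lemma near_open x (P : 'rV[R]_n -> Prop) :
  U x -> (forall y, U y -> P y) -> \forall y \near x, P y.
Proof. by move=> Ux H; apply: filterS H _; exact: open_nbhs_nbhs. Qed.

Lemma smooth_continuous f x : smooth_on U f -> U x -> {for x, continuous f}.
Proof. by move=> sf Ux; have [] := sf [::] x Ux. Qed.

Lemma smooth_on_pderiv f i : smooth_on U f -> smooth_on U (pderiv i f).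
Proof.
move=> sf s x Ux; have := sf (rcons s i) x Ux.
by rewrite /iter_pderiv foldr_rcons.
Qed.

Lemma iter_pderiv_eq f g s : (forall x, U x -> f x = g x) ->
  forall x, U x -> iter_pderiv s f x = iter_pderiv s g x.
Proof.
move=> fg; elim: s => //= i s IH x Ux.
apply: near_eq_derive; exact: near_open.
Qed.

Lemma smooth_on_eq f g : (forall x, U x -> f x = g x) ->
  smooth_on U f -> smooth_on U g.
Proof.
move=> fg sf s x Ux; have [cf df] := sf s x Ux; split.
  have E := iter_pderiv_eq s fg.
  suff: iter_pderiv s g @ x --> iter_pderiv s g x by [].
  rewrite -(E x Ux); apply: near_eq_continuous cf; exact: (near_open Ux).
move=> i; apply: near_eq_derivable (df i).
by apply: near_open => // y Uy; rewrite (iter_pderiv_eq s fg).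
Qed.

Lemma is_derive_smooth f x v : smooth_on U f -> U x ->
  is_derive x v f (\sum_i v ord0 i * pderiv i f x).
Proof.
move=> sf Ux; rewrite [X in is_derive _ X _ _]row_sum_delta.
have H r : is_derive x (\sum_(i <- r) v ord0 i *: delta_mx ord0 i) f
    (\sum_(i <- r) v ord0 i * pderiv i f x).
  elim: r => [|i r IH]; first by rewrite !big_nil; exact: is_derive0.
  rewrite !big_cons addrC [X in is_derive _ _ _ X]addrC.
  apply: is_derive_add_dir => //.
    by apply: near_open => // y Uy; have [_] := sf [::] y Uy; exact.
  by have [] := sf [:: i] x Ux.
exact: H.
Qed.

Lemma derive_smooth f x v : smooth_on U f -> U x ->
  'D_v f x = \sum_i v ord0 i * pderiv i f x.
Proof. by move=> sf Ux; have [_] := is_derive_smooth v sf Ux. Qed.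

Lemma derivable_smooth f x v : smooth_on U f -> U x -> derivable f x v.
Proof. by move=> sf Ux; have [] := is_derive_smooth v sf Ux. Qed.

Lemma smooth_on_sum (I : finType) (a : I -> R) (F : I -> 'rV[R]_n -> R) :
  (forall i, smooth_on U (F i)) -> smooth_on U (fun x => \sum_i a i * F i x).
Proof.
move=> sF s x Ux.
have E : forall s y, U y -> iter_pderiv s (fun x => \sum_i a i * F i x) y =
   \sum_i a i * iter_pderiv s (F i) y.
  move=> {s}s; elim: s => //= j s IH y Uy.
  have H : is_derive y (delta_mx ord0 j) (fun x => \sum_i a i * iter_pderiv s (F i) x)
     (\sum_i a i * pderiv j (iter_pderiv s (F i)) y).
    apply: (@is_derive_lincomb _ _ a (fun i => iter_pderiv s (F i))) => i.
    by apply: derivableP; have [_ dF] := sF i s y Uy; exact: dF.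
  rewrite -(@derive_val _ _ _ _ _ _ _ H).
  apply: near_eq_derive; exact: near_open.
split.
  pose G x := \sum_i a i * F i x.
  suff: iter_pderiv s G @ x --> iter_pderiv s G x by [].
  rewrite /G E //.
  apply: (@near_eq_continuous _ (fun y => \sum_i a i * iter_pderiv s (F i) y)).
    by apply: (near_open Ux) => y Uy; rewrite E.
  apply: (@cvg_lincomb _ _ a (fun i => iter_pderiv s (F i))) => i; have [h _] := sF i s x Ux; exact: h.
move=> j; apply: (@near_eq_derivable _ _ _ (fun y => \sum_i a i * iter_pderiv s (F i) y)).
- by apply: near_open => // y Uy; rewrite E.
apply: (@ex_derive _ _ _ _ _ _ _ (@is_derive_lincomb _ _ a
   (fun i => iter_pderiv s (F i)) (fun i => pderiv j (iter_pderiv s (F i)) x) _ _ _)) => i.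
by apply: derivableP; have [_ dF] := sF i s x Ux; exact: dF.
Qed.

(** Lets derivatives along arbitrary directions be iterated, which the
    eigenvector frame of the Hessian requires. *)
Lemma smooth_on_derive f v : smooth_on U f -> smooth_on U ('D_v f).
Proof.
move=> sf; apply: (@smooth_on_eq (fun x => \sum_i v ord0 i * pderiv i f x)).
  by move=> x Ux; rewrite derive_smooth.
by apply: smooth_on_sum => i; exact: smooth_on_pderiv.
Qed.

Lemma derive_eq_on f g v x : U x -> (forall y, U y -> f y = g y) -> 'D_v f x = 'D_v g x.
Proof.
by move=> Ux fg; apply: near_eq_derive; exact: near_open.
Qed.

(** Two applications of the mean value theorem, first along v to the increment
    in w, then along w. The second difference is symmetric in v and w, hence
    the symmetry of mixed derivatives. *)
Lemma second_difference f x v w : smooth_on U f -> U x ->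
  forall e : R, 0 < e -> \forall h \near (0 : R),
   `|f (x + h *: v + h *: w) - f (x + h *: v) - f (x + h *: w) + f x
      - h ^+ 2 * 'D_w ('D_v f) x| <= e * h ^+ 2.
Proof.
move=> sf Ux e e0.
have := smooth_continuous (smooth_on_derive w (smooth_on_derive v sf)) Ux.
move=> /cvgrPdist_lt/(_ e e0) Hc.
have /nbhs_ballP[r /= r0 hr] : \forall y \near x,
    U y /\ `|'D_w ('D_v f) x - 'D_w ('D_v f) y| < e.
  near=> y; split; last by near: y.
  by near: y; exact: open_nbhs_nbhs.
pose W := `|v| + `|w| + 1.
have W0 : 0 < W by rewrite /W ltr_wpDl // addr_ge0.
near=> h.
have hW : `|h| * W < r.
  by rewrite -ltr_pdivlMr //; near: h; apply: near0_norm_lt; rewrite divr_gt0.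
have close s t : `|s| <= `|h| -> `|t| <= `|h| ->
    U (x + s *: v + t *: w) /\
    `|'D_w ('D_v f) x - 'D_w ('D_v f) (x + s *: v + t *: w)| < e.
  move=> hs ht; apply: hr; rewrite -ball_normE /=.
  rewrite -addrA opprD addNKr normrN.
  apply: le_lt_trans hW; apply: (le_trans (ler_normD _ _)).
  rewrite /W mulrDr mulr1 -[leLHS]addr0 lerD // mulrDr !normrZ lerD //;
    by rewrite ler_wpM2r.
have h0 : `|0 : R| <= `|h| by rewrite normr0.
have [|s hs hm] := @mvt_from0 _ (fun s => f (x + h *: w + s *: v) - f (x + s *: v))
   (fun s => 'D_v f (x + s *: v + h *: w) - 'D_v f (x + s *: v)) h.
  move=> s hs /=.
  apply: is_derive_subfun;
    apply: is_derive_line.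
    rewrite addrAC; apply: derivableP; apply: derivable_smooth => //.
    by have [] := close s h hs (lexx _).
  apply: derivableP; apply: derivable_smooth => //.
  by have [] := close s 0 hs h0; rewrite scale0r addr0.
have [|t ht hm2] := @mvt_from0 _ (fun t => 'D_v f (x + s *: v + t *: w))
   (fun t => 'D_w ('D_v f) (x + s *: v + t *: w)) h.
  move=> t ht /=; apply: (@is_derive_line _ _ ('D_v f)).
  apply: derivableP; apply: derivable_smooth; first exact: smooth_on_derive.
  by have [] := close s t hs ht.
have -> : f (x + h *: v + h *: w) - f (x + h *: v) - f (x + h *: w) + f x
      - h ^+ 2 * 'D_w ('D_v f) x =
  h ^+ 2 * ('D_w ('D_v f) (x + s *: v + t *: w) - 'D_w ('D_v f) x).
  move: hm2 => /[1!scale0r] /[1!addr0] hm2.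
  move: hm; rewrite hm2 !scale0r !addr0 [x + h *: w + _]addrAC.
  move: ('D_w ('D_v f) (x + s *: v + t *: w)) ('D_w ('D_v f) x) => p q.
  move: (f (x + h *: v + h *: w)) (f (x + h *: v)) (f (x + h *: w)) (f x) => a b c d e1.
  have -> : a - b - c + d = h * (h * p) by rewrite -e1; ring.
  by ring.
rewrite normrM [leLHS]mulrC [`|h ^+ 2|]ger0_norm ?sqr_ge0 // ler_wpM2r ?sqr_ge0 // distrC.
by have [_ /ltW] := close s t hs ht.
Unshelve. all: by end_near. Qed.

Lemma schwarz f x v w : smooth_on U f -> U x ->
  'D_v ('D_w f) x = 'D_w ('D_v f) x.
Proof.
move=> sf Ux; apply/eqP; rewrite -subr_eq0 -normr_le0.
apply/ler_addgt0Pl => e e0; rewrite addr0.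
have e20 : 0 < e / 2 by lra.
have [r /= r0 hr] : \forall h \near (0 : R),
   `|f (x + h *: v + h *: w) - f (x + h *: v) - f (x + h *: w) + f x
      - h ^+ 2 * 'D_w ('D_v f) x| <= e / 2 * h ^+ 2 /\
   `|f (x + h *: w + h *: v) - f (x + h *: w) - f (x + h *: v) + f x
      - h ^+ 2 * 'D_v ('D_w f) x| <= e / 2 * h ^+ 2.
  apply: filterS2 (second_difference v w sf Ux e20) (second_difference w v sf Ux e20) => h h1 h2;
    exact (conj h1 h2).
have hh : `|r / 2| < r by rewrite gtr0_norm ?divr_gt0 //; lra.
have := hr (r / 2); rewrite /= sub0r normrN => /(_ hh).
have : 0 < (r / 2) ^+ 2 by rewrite exprn_gt0 // divr_gt0.
move: (r / 2) => h {hh hr r0 r}; rewrite [x + h *: w + h *: v]addrAC.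
move: (f (x + h *: v + h *: w)) (f (x + h *: v)) (f (x + h *: w)) (f x).
move: ('D_w ('D_v f) x) ('D_v ('D_w f) x) (h ^+ 2) => p q h2 a b c d h20 [h1 h1'].
rewrite -(ler_pM2r h20) -[X in _ * X <= _](gtr0_norm h20) -normrM.
have -> : (q - p) * h2 = (a - b - c + d - h2 * p) - (a - c - b + d - h2 * q) by ring.
have -> : e * h2 = e / 2 * h2 + e / 2 * h2 by rewrite -mulrDl -splitr.
by apply: (le_trans (ler_normB _ _)); apply: lerD.
Qed.

Lemma jet_smooth_line f x v : smooth_on U f -> U x ->
  jet (fun t => f (x + t *: v)) (f x) ('D_v f x) ('D_v ('D_v f) x / 2).
Proof.
move=> sf Ux; pose g t := f (x + t *: v); pose dg t := 'D_v f (x + t *: v).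
have -> : f x = g 0 by rewrite /g scale0r addr0.
have -> : 'D_v f x = dg 0 by rewrite /dg scale0r addr0.
apply: jet_taylor.
  have := near_line v (near_open Ux (fun y Uy => Uy)); apply: filterS => t Ut.
  by apply: is_derive_line; apply: derivableP; exact: derivable_smooth.
apply: (@is_derive_line _ _ ('D_v f)); rewrite scale0r addr0; apply: derivableP.
by apply: derivable_smooth => //; exact: smooth_on_derive.
Qed.

End OpenSet.
End Smooth.

(** * Orthogonal diagonalisation of symmetric matrices with split characteristic polynomial *)

Lemma horner_char_poly (K : comNzRingType) n (A : 'M[K]_n) (x : K) :
  (char_poly A).[x] = \det (x%:M - A).
Proof.
rewrite /char_poly -/(horner_eval x _) -det_map_mx; congr (\det _).
apply/matrixP => i j; rewrite !mxE /= /horner_eval hornerD hornerN hornerC.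
by rewrite hornerMn hornerX.
Qed.

Section Spectral.
Variable R : rcfType.

Lemma row_dot_ge0 n (v : 'rV[R]_n) : 0 <= (v *m v^T) 0 0.
Proof. by rewrite mxE sumr_ge0 // => i _; rewrite !mxE -expr2 sqr_ge0. Qed.

Lemma row_dot_eq0 n (v : 'rV[R]_n) : ((v *m v^T) 0 0 == 0) = (v == 0).
Proof.
apply/eqP/eqP => [|->]; last by rewrite mul0mx mxE.
rewrite mxE => /eqP; rewrite psumr_eq0 => [/allP h|i _]; last by rewrite mxE -expr2 sqr_ge0.
apply/rowP => j; have := h j (mem_index_enum _).
by rewrite !mxE /= -expr2 sqrf_eq0 => /eqP.
Qed.

(** A Householder reflection in the hyperplane orthogonal to v - e, where e is
    the first basis vector, exchanges e and v. *)
Lemma orthogonal_first_row n (v : 'rV[R]_n.+1) : v *m v^T = 1%:M ->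
  exists2 P : 'M[R]_n.+1, P *m P^T = 1%:M & delta_mx 0 0 *m P = v.
Proof.
move=> v1; set e : 'rV[R]_n.+1 := delta_mx 0 0.
have [<-|ve] := eqVneq e v.
  by exists 1%:M; [rewrite trmx1 mulmx1 | rewrite mulmx1].
pose w := v - e; pose c := (w *m w^T) 0 0.
have cn0 : c != 0 by rewrite row_dot_eq0 subr_eq0 eq_sym.
have wwc : w *m w^T = c%:M by rewrite [LHS]mx11_scalar.
have ee : e *m e^T = 1%:M.
  by apply/matrixP => i j; rewrite trmx_delta mul_delta_mx !ord1 !mxE !eqxx.
have evve : e *m v^T = v *m e^T.
  have -> : v *m e^T = (e *m v^T)^T by rewrite trmx_mul trmxK.
  by apply/matrixP => i j; rewrite !ord1 [RHS]mxE.
pose d := (v *m e^T) 0 0.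
have ved : v *m e^T = d%:M by rewrite [LHS]mx11_scalar.
have cd : c = 2 - 2 * d.
  have : w *m w^T = (2 - 2 * d)%:M.
    rewrite /w linearB /= mulmxBl !mulmxBr v1 ee evve ved.
    by rewrite -!raddfB /=; congr _%:M; ring.
  by rewrite wwc => /matrixP/(_ 0 0); rewrite !mxE eqxx !mulr1n.
pose P := 1%:M - (2 / c) *: (w^T *m w).
have PT : P^T = P.
  by rewrite /P linearB linearZ /= trmx_mul trmxK trmx1.
exists P.
  rewrite PT /P; set S := w^T *m w.
  have SS : S *m S = c *: S.
    by rewrite /S mulmxA -[_ *m w *m w^T]mulmxA wwc mul_mx_scalar -scalemxAl.
  rewrite mulmxBl mul1mx mulmxBr mulmx1 -scalemxAr -scalemxAl SS !scalerA.
  have -> : 2 / c * (2 / c) * c = 2 / c + 2 / c by field.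
  by rewrite scalerDl; apply/matrixP => i j; rewrite !mxE; ring.
rewrite /P mulmxBr mulmx1 -scalemxAr mulmxA.
have -> : e *m w^T = (d - 1)%:M by rewrite /w linearB /= mulmxBr evve ved ee -raddfB.
rewrite mul_scalar_mx scalerA.
have -> : 2 / c * (d - 1) = -1 by rewrite cd in cn0 *; field; exact: cn0.
by rewrite scaleN1r opprK /w addrC subrK.
Qed.

Lemma char_poly_conj n (P A : 'M[R]_n) : P *m P^T = 1%:M ->
  char_poly (P *m A *m P^T) = char_poly A.
Proof.
move=> P1; pose Q := map_mx polyC P.
have Q1 : Q *m Q^T = 1%:M by rewrite /Q map_trmx -map_mxM P1 map_mx1.
rewrite /char_poly.
have -> : char_poly_mx (P *m A *m P^T) = Q *m char_poly_mx A *m Q^T.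
  rewrite /char_poly_mx mulmxBr mulmxBl !map_mxM /= -map_trmx -/Q.
  by rewrite mul_mx_scalar -scalemxAl Q1 scalemx1.
rewrite !det_mulmx mulrAC -det_mulmx Q1 det1 mul1r //.
Qed.

(** An orthogonal matrix whose first row is a unit eigenvector splits off a
    block, and symmetry kills the off-diagonal part. The characteristic
    polynomial of the remaining block is obtained by cancelling one linear
    factor, so it splits as well and the induction goes on. Since the
    characteristic polynomial is assumed to split, no root has to be found. *)
Lemma spectral_symmetric n (A : 'M[R]_n) (lam : 'I_n -> R) : A^T = A ->
  char_poly A = \prod_(i < n) ('X - (lam i)%:P) ->
  exists2 Q : 'M[R]_n, Q *m Q^T = 1%:M & exists d, Q *m A *m Q^T = diag_mx d.
Proof.
elim: n A lam => [|n IH] A lam AT chA.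
  by exists 1%:M; [apply/matrixP => -[] | exists 0; apply/matrixP => -[]].
have : eigenvalue A (lam 0).
  rewrite eigenvalue_root_char chA; apply/rootP; rewrite big_ord_recl hornerM.
  by rewrite hornerXsubC subrr mul0r.
move=> /eigenvalueP[v0 v0A v0n0].
pose c := (v0 *m v0^T) 0 0.
have c0 : 0 < c by rewrite lt_def row_dot_eq0 v0n0 row_dot_ge0.
pose v := (Num.sqrt c)^-1 *: v0.
have vA : v *m A = lam 0 *: v by rewrite /v -scalemxAl v0A !scalerA mulrC.
have vv : v *m v^T = 1%:M.
  rewrite /v linearZ /= -scalemxAl -scalemxAr scalerA -invfM -expr2 sqr_sqrtr ?ltW //.
  by rewrite [_ *m _]mx11_scalar -/c scale_scalar_mx mulVf ?gt_eqF.
have [P P1 eP] := orthogonal_first_row vv.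
have P1' : P^T *m P = 1%:M by exact: mulmx1C.
have [B defB] : exists B : 'M[R]_(1 + n), B = P *m A *m P^T by exists (P *m A *m P^T).
have BT : B^T = B by rewrite defB !trmx_mul trmxK AT mulmxA.
have eB : delta_mx 0 0 *m B = lam 0 *: (delta_mx 0 0 : 'rV[R]_(1 + n)).
  by rewrite defB !mulmxA eP vA -scalemxAl -eP -mulmxA P1 mulmx1.
have B0 j : B 0 j = lam 0 * (j == 0)%:R.
  by have /matrixP/(_ 0 j) := eB; rewrite -rowE !mxE eqxx.
have Bblock : B = block_mx (lam 0)%:M 0 0 (drsubmx B).
  rewrite -[LHS]submxK; congr block_mx.
  - apply/matrixP => i j; rewrite !ord1 !mxE.
    have -> : lshift n 0 = 0 :> 'I_(1 + n) by apply: val_inj.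
    by rewrite B0 eqxx mulr1 mulr1n.
  - apply/matrixP => i j; rewrite !ord1 !mxE.
    have -> : lshift n 0 = 0 :> 'I_(1 + n) by apply: val_inj.
    by rewrite B0 mulr0.
  - apply/matrixP => i j; rewrite !ord1 !mxE -BT mxE.
    have -> : lshift n 0 = 0 :> 'I_(1 + n) by apply: val_inj.
    by rewrite B0 mulr0.
set B' := drsubmx B in Bblock.
have B'T : B'^T = B' by rewrite /B' trmx_drsub BT.
have chB' : char_poly B' = \prod_(i < n) ('X - (lam (lift ord0 i))%:P).
  have : char_poly B = char_poly A by rewrite defB; exact: char_poly_conj.
  rewrite chA Bblock big_ord_recl /char_poly /char_poly_mx.
  rewrite map_block_mx /= !map_mx0 (@scalar_mx_block _ 1 n) opp_block_mx add_block_mx.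
  rewrite !oppr0 !addr0 det_ublock map_scalar_mx /= -raddfB det_scalar1.
  by apply: mulfI; rewrite polyXsubC_eq0.
have [Q' Q'1 [d' Q'd]] := IH B' _ B'T chB'.
pose Q : 'M[R]_(1 + n) := block_mx 1%:M 0 0 Q'.
have QT : Q^T = block_mx 1%:M 0 0 Q'^T by rewrite /Q tr_block_mx !trmx0 trmx1.
exists (Q *m P).
  rewrite trmx_mul mulmxA -[Q *m P *m _]mulmxA P1 mulmx1 QT /Q (@mulmx_block _ 1 n 1 n 1 n).
  by rewrite !mulmx0 !mul0mx !addr0 !add0r mulmx1 Q'1 -scalar_mx_block.
exists (row_mx (lam 0)%:M d').
rewrite trmx_mul !mulmxA -[Q *m P *m A]mulmxA -[Q *m (P *m A) *m _]mulmxA -defB.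
rewrite QT /Q Bblock !(@mulmx_block _ 1 n 1 n 1 n).
rewrite ?mulmx0 ?mul0mx ?addr0 ?add0r ?mul0mx ?mulmx0 ?addr0 ?mul1mx ?mulmx1 ?Q'd.
rewrite (@diag_mx_row _ n 1).
have -> // : diag_mx (lam 0)%:M = (lam 0)%:M :> 'M[R]_1.
by apply/matrixP => i j; rewrite !ord1 !mxE.
Qed.

End Spectral.

(** * Second-order expansions of determinants *)

Section ComplexJets.
Variable R : realType.
Local Notation C := (R[i]).
Implicit Types (f g : R -> C) (a b c : C).

(** Expansions of complex-valued functions of a real variable, componentwise. *)
Definition cjet f a b c :=
  jet (fun t => complex.Re (f t)) (complex.Re a) (complex.Re b) (complex.Re c) /\
  jet (fun t => complex.Im (f t)) (complex.Im a) (complex.Im b) (complex.Im c).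

Definition creal (t : R) : C := real_complex R t.

Lemma creal0 : creal 0 = 0. Proof. by []. Qed.
Lemma creal1 : creal 1 = 1. Proof. by []. Qed.
Lemma crealN x : creal (- x) = - creal x. Proof. exact: rmorphN. Qed.
Lemma crealM x y : creal (x * y) = creal x * creal y. Proof. exact: rmorphM. Qed.
Lemma crealX x n : creal (x ^+ n) = creal x ^+ n. Proof. exact: rmorphXn. Qed.

Lemma cjet_ext f g a b c : (forall t, f t = g t) -> cjet f a b c -> cjet g a b c.
Proof. by move=> /funext ->. Qed.

Lemma cjet_cst a : cjet (fun=> a) a 0 0.
Proof. by split; exact: jet_cst. Qed.

Lemma cjet_real (f : R -> R) (a b c : R) : jet f a b c ->
  cjet (fun t => creal (f t)) (creal a) (creal b) (creal c).
Proof. by move=> jf; split => //=; exact: jet_cst. Qed.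

Lemma cReD (x y : C) : complex.Re (x + y) = complex.Re x + complex.Re y.
Proof. by case: x y => [? ?] []. Qed.
Lemma cImD (x y : C) : complex.Im (x + y) = complex.Im x + complex.Im y.
Proof. by case: x y => [? ?] []. Qed.
Lemma cReM (x y : C) : complex.Re (x * y) =
  complex.Re x * complex.Re y - complex.Im x * complex.Im y.
Proof. by case: x y => [? ?] []. Qed.
Lemma cImM (x y : C) : complex.Im (x * y) =
  complex.Re x * complex.Im y + complex.Im x * complex.Re y.
Proof. by case: x y => [? ?] []. Qed.

Lemma cjetD f g a b c a' b' c' : cjet f a b c -> cjet g a' b' c' ->
  cjet (fun t => f t + g t) (a + a') (b + b') (c + c').
Proof.
move=> [jf1 jf2] [jg1 jg2]; split; rewrite ?cReD ?cImD.
  by under eq_fun do rewrite cReD; exact: jetD.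
by under eq_fun do rewrite cImD; exact: jetD.
Qed.

Lemma cjetM f g a b c a' b' c' : cjet f a b c -> cjet g a' b' c' ->
  cjet (fun t => f t * g t) (a * a') (a * b' + b * a')
    (a * c' + b * b' + c * a').
Proof.
move=> [jf1 jf2] [jg1 jg2]; split; rewrite ?cReD ?cImD ?cReM ?cImM.
  under eq_fun do rewrite cReM.
  have := jetB (jetM jf1 jg1) (jetM jf2 jg2).
  by congr jet; ring.
under eq_fun do rewrite cImM.
have := jetD (jetM jf1 jg2) (jetM jf2 jg1).
by congr jet; ring.
Qed.

Lemma cjet_uniq f a b c a' b' c' : cjet f a b c -> cjet f a' b' c' ->
  [/\ a = a', b = b' & c = c'].
Proof.
move=> [j1 j2] [k1 k2].
have [r1 r2 r3] := jet_uniq j1 k1; have [i1 i2 i3] := jet_uniq j2 k2.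
case: a b c a' b' c' r1 r2 r3 i1 i2 i3 {j1 j2 k1 k2} => [? ?] [? ?] [? ?] [? ?] [? ?] [? ?] /=.
by do 6!move=> ->.
Qed.

Lemma cjet_comp0 (g : R -> C) (f : R -> R) (g0 g1 g2 : C) (b c : R) :
  cjet g g0 g1 g2 -> jet f 0 b c ->
  cjet (fun t => g (f t)) g0 (g1 * creal b) (g1 * creal c + g2 * creal b ^+ 2).
Proof.
move=> [j1 j2] jf; have := jet_comp0 j1 jf; have := jet_comp0 j2 jf.
case: g0 g1 g2 {j1 j2} => [? ?] [? ?] [? ?] j1 j2.
split; [move: j2 | move: j1]; congr jet => /=; ring.
Qed.

Lemma cjet_id : cjet creal 0 1 0.
Proof. by split; [exact: jet_id | exact: jet_cst]. Qed.

Lemma cjet_horner (p : {poly C}) : cjet (fun t => p.[creal t]) p`_0 p`_1 p`_2.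
Proof.
elim/poly_ind: p => [|p c IH].
  rewrite !coef0; apply: cjet_ext (cjet_cst 0) => t; by rewrite horner0.
rewrite !coefD !coefMX !coefC /= add0r !addr0.
have := cjetD (cjetM IH cjet_id) (cjet_cst c).
rewrite !mulr0 !add0r !addr0 !mulr1 ?add0r.
by apply: cjet_ext => t; rewrite hornerMXaddC.
Qed.

(** By the Leibniz formula the determinant is a polynomial in the entries, so
    its expansion depends on theirs only. The point of the existential is to
    transport an expansion from one matrix curve to another with the same
    entrywise expansions. *)
Lemma cjet_det n (M0 M1 M2 : 'M[C]_n) : exists d0 d1 d2,
  forall M : R -> 'M[C]_n,
  (forall i j, cjet (fun t => M t i j) (M0 i j) (M1 i j) (M2 i j)) ->
  cjet (fun t => \det (M t)) d0 d1 d2.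
Proof.
pose good (F : (R -> 'M[C]_n) -> R -> C) := exists d0 d1 d2,
  forall M : R -> 'M[C]_n,
  (forall i j, cjet (fun t => M t i j) (M0 i j) (M1 i j) (M2 i j)) ->
  cjet (F M) d0 d1 d2.
have gprod (s : 'S_n) (r : seq 'I_n) : good (fun M t => \prod_(i <- r) M t i (s i)).
  elim: r => [|i r [d0 [d1 [d2 IH]]]].
    by exists 1, 0, 0 => M _; apply: cjet_ext (cjet_cst 1) => t; rewrite big_nil.
  do 3 eexists; move=> M jM.
  by apply: cjet_ext (cjetM (jM i (s i)) (IH M jM)) => t; rewrite big_cons.
have gsum (r : seq 'S_n) : good (fun M t => \sum_(s <- r) (-1) ^+ s * \prod_i M t i (s i)).
  elim: r => [|s r [d0 [d1 [d2 IH]]]].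
    by exists 0, 0, 0 => M _; apply: cjet_ext (cjet_cst 0) => t; rewrite big_nil.
  have [e0 [e1 [e2 H]]] := gprod s (index_enum 'I_n).
  do 3 eexists; move=> M jM.
  apply: cjet_ext (cjetD (cjetM (cjet_cst ((-1) ^+ s)) (H M jM)) (IH M jM)) => t.
  by rewrite big_cons.
exact: gsum.
Qed.

(** Up to reversal of the coefficients this is the characteristic polynomial of
    -N, whose subleading coefficient is a trace. *)
Lemma det_1pX n (N : 'M[C]_n.+1) : exists p : {poly C},
  [/\ p`_0 = 1, p`_1 = \tr N & forall x : C, \det (1%:M + x *: N) = p.[x]].
Proof.
pose q := char_poly (- N); pose p := \poly_(j < n.+2) q`_(n.+1 - j).
have sq : size q = n.+2 by exact: size_char_poly.
have q1 : q`_n.+1 = 1.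
  by have := monicP (char_poly_monic (- N)); rewrite /lead_coef sq.
exists p; split.
- by rewrite coef_poly /= subn0.
- by rewrite coef_poly /= subn1 /= (char_poly_trace (- N)) // linearN opprK.
move=> x.
have [->|xn0] := eqVneq x 0.
  by rewrite scale0r addr0 det1 horner_coef0 coef_poly.
have -> : 1%:M + x *: N = x *: (x^-1%:M - - N).
  by rewrite opprK scalerDr scale_scalar_mx divff.
rewrite detZ.
rewrite -horner_char_poly -/q.
rewrite (horner_coef q) sq (@horner_coef_wide _ n.+2 p); last exact: size_poly.
rewrite big_distrr /= (reindex_inj rev_ord_inj) /=; apply: eq_bigr => i _.
rewrite coef_poly ltn_ord subSS mulrCA; congr (_ * _).
have ile : (i <= n.+1)%N by rewrite -ltnS.
rewrite -{1}(subnK ile) exprD mulrAC -exprMn divff // expr1n mul1r //.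
Qed.

(** The quadratic coefficient c of det(1 + t N) follows from the linear one:
    det(1 + t N) det(1 - t N) = det(1 - t^2 N^2), and comparing the
    coefficients of t^2 gives 2 c - (tr N)^2 = - tr(N^2). *)
Lemma cjet_det_1pX n (N : 'M[C]_n.+1) :
  cjet (fun t => \det (1%:M + creal t *: N)) 1 (\tr N)
    ((\tr N ^+ 2 - \tr (N *m N)) / 2) /\
  cjet (fun t => \det (1%:M + creal (t ^+ 2) *: N)) 1 0 (\tr N).
Proof.
have jsq M : cjet (fun t => \det (1%:M + creal (t ^+ 2) *: M)) 1 0 (\tr (M : 'M[C]_n.+1)).
  have [p [p0 p1 pE]] := det_1pX M.
  have j2 : jet (fun t : R => t ^+ 2) 0 0 1.
    have := jetM (@jet_id R) (@jet_id R).
    by rewrite !mulr0 !mul0r mulr1 !addr0 add0r; apply: jet_ext; near=> t; rewrite expr2.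
  have := cjet_comp0 (cjet_horner p) j2.
  rewrite p0 p1 creal0 creal1 expr0n /= !mulr0 mulr1 addr0.
  by apply: cjet_ext => t; rewrite pE.
split; last exact: jsq.
have [p [p0 p1 pE]] := det_1pX N.
have jp : cjet (fun t => \det (1%:M + creal t *: N)) 1 (\tr N) p`_2.
  by have := cjet_horner p; rewrite p0 p1; apply: cjet_ext => t; rewrite pE.
have jN := @jet_opp R.
have jm : cjet (fun t => \det (1%:M - creal t *: N)) 1 (- \tr N) p`_2.
  have := cjet_comp0 jp jN.
  rewrite crealN creal1 creal0 mulrN1 mulr0 add0r sqrrN expr1n mulr1.
  by apply: cjet_ext => t; rewrite crealN scaleNr.
have E t : \det (1%:M + creal t *: N) * \det (1%:M - creal t *: N) =
    \det (1%:M + creal (t ^+ 2) *: (- (N *m N))).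
  rewrite -det_mulmx mulmxBr !mulmxDl !mul1mx mulmx1 -scalemxAl -scalemxAr scalerA.
  by rewrite expr2 crealM scalerN opprD addrA addrK.
have [_ _] := cjet_uniq (cjet_ext E (cjetM jp jm)) (jsq (- (N *m N))).
rewrite linearN /= mul1r mulr1 => H.
have <- // : p`_2 = (\tr N ^+ 2 - \tr (N *m N)) / 2.
rewrite -H; field.
Unshelve. all: by end_near. Qed.


End ComplexJets.

(** * Expansion of the special Lagrangian phase *)

Section DetJet.
Variable R : realType.
Local Notation C := (R[i]).

Lemma complex_ext (x y : C) : complex.Re x = complex.Re y ->
  complex.Im x = complex.Im y -> x = y.
Proof. by case: x y => [? ?] [? ?] /= -> ->. Qed.

Definition imagC : C := Complex 0 1.

(** Near 0 the matrix 1 + i H(t) agrees to second order with the product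
    M (1 + t N1) (1 + t^2 N2), where M = 1 + i H(0) is diagonal and N1, N2 are
    i A and i B divided by M; P lists the entries of i / M. *)
Lemma cjet_det_diag n (H : R -> 'M[R]_n.+1) (l : 'I_n.+1 -> R) (A B : 'M[R]_n.+1)
    (P : 'I_n.+1 -> C) :
  (forall i, P i * (1 + imagC * creal (l i)) = imagC) ->
  (forall i j, jet (fun t => H t i j) (l i *+ (i == j)) (A i j) (B i j)) ->
  let D := \prod_i (1 + imagC * creal (l i)) in
  let T := \sum_i P i * creal (A i i) in
  cjet (fun t => \det (1%:M + imagC *: map_mx (@creal R) (H t)))
    D (D * T)
    (D * (T ^+ 2 / 2 - (\sum_i \sum_j P i * P j * creal (A i j * A j i)) / 2
          + \sum_i P i * creal (B i i))).
Proof.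
move=> hP jH D T; pose m i := 1 + imagC * creal (l i).
have hP' i : m i * P i = imagC by rewrite mulrC hP.
pose N1 := \matrix_(i, j) (P i * creal (A i j)).
pose N2 := \matrix_(i, j) (P i * creal (B i j)).
pose dm := diag_mx (\row_i m i).
(* The product model of 1 + i H(t): its error is exactly cubic in t. *)
pose Mt t := dm *m (1%:M + creal t *: N1) *m (1%:M + creal (t ^+ 2) *: N2).
have MtE t i j : Mt t i j = m i *+ (i == j) + creal t * (imagC * creal (A i j)) +
   creal t ^+ 2 * (imagC * creal (B i j) + creal t * ((dm *m N1) *m N2) i j).
  have -> : Mt t = dm + creal t *: (dm *m N1) + creal t ^+ 2 *: (dm *m N2 +
      creal t *: ((dm *m N1) *m N2)).
    rewrite /Mt crealX !mulmxDr !mulmxDl !mulmx1 -!scalemxAr -!scalemxAl !scalerDr scalerA.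
    by rewrite addrACA addrA.
  have dE N a b : (dm *m N) a b = m a * N a b by rewrite /dm mul_diag_mx !mxE.
  rewrite mxE [X in X + _]mxE; congr (_ + _ + _).
  - by rewrite /dm !mxE.
  - by rewrite mxE dE [N1 i j]mxE [m i * _]mulrA hP'.
  by rewrite mxE [X in _ * X]mxE dE [X in _ * (_ + X) = _]mxE [N2 i j]mxE [m i * _]mulrA hP'.
have jMt i j : cjet (fun t => Mt t i j) (m i *+ (i == j)) (imagC * creal (A i j))
    (imagC * creal (B i j)).
  set X := ((dm *m N1) *m N2) i j in MtE.
  have j1 := cjetM (@cjet_id R) (cjet_cst (imagC * creal (A i j))).
  have j2 := cjetM (cjetM (@cjet_id R) (@cjet_id R))
    (cjetD (cjet_cst (imagC * creal (B i j))) (cjetM (@cjet_id R) (cjet_cst X))).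
  have := cjetD (cjetD (cjet_cst (m i *+ (i == j))) j1) j2.
  rewrite !(mul0r, mulr0, mulr1, mul1r, addr0, add0r).
  by apply: cjet_ext => t; rewrite MtE expr2.
have jM i j : cjet (fun t => (1%:M + imagC *: map_mx (@creal R) (H t)) i j)
    (m i *+ (i == j)) (imagC * creal (A i j)) (imagC * creal (B i j)).
  have := cjetD (cjet_cst ((i == j)%:R : C)) (cjetM (cjet_cst imagC) (cjet_real (jH i j))).
  rewrite !(mul0r, addr0, add0r).
  have -> : (i == j)%:R + imagC * creal (l i *+ (i == j)) = m i *+ (i == j).
    by case: (i == j); rewrite ?mulr1n // !mulr0n creal0 mulr0 addr0.
  by apply: cjet_ext => t; rewrite !mxE.
have [d0 [d1 [d2 Hd]]] := cjet_det (\matrix_(i, j) (m i *+ (i == j)))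
  (\matrix_(i, j) (imagC * creal (A i j))) (\matrix_(i, j) (imagC * creal (B i j))).
have jM' : cjet (fun t => \det (1%:M + imagC *: map_mx (@creal R) (H t))) d0 d1 d2.
  by apply: Hd => i j; rewrite [X in cjet _ X]mxE [X in cjet _ _ X]mxE [X in cjet _ _ _ X]mxE.
have jMt' : cjet (fun t => \det (Mt t)) d0 d1 d2.
  by apply: Hd => i j; rewrite [X in cjet _ X]mxE [X in cjet _ _ X]mxE [X in cjet _ _ _ X]mxE.
have [j1 _] := cjet_det_1pX N1; have [_ j2] := cjet_det_1pX N2.
have := cjetM (cjetM (cjet_cst D) j1) j2.
have trN1 : \tr N1 = T by apply: eq_bigr => i _; rewrite mxE.
have trN2 : \tr N2 = \sum_i P i * creal (B i i) by apply: eq_bigr => i _; rewrite mxE.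
have trN11 : \tr (N1 *m N1) = \sum_i \sum_j P i * P j * creal (A i j * A j i).
  apply: eq_bigr => i _; rewrite mxE; apply: eq_bigr => j _.
  by rewrite !mxE crealM; ring.
have detdm : \det dm = D by rewrite det_diag; apply: eq_bigr => i _; rewrite mxE.
move=> jj.
have {jj} jj : cjet (fun t => \det (Mt t)) D (D * T) (D * (T ^+ 2 / 2 -
    (\sum_i \sum_j P i * P j * creal (A i j * A j i)) / 2
          + \sum_i P i * creal (B i i))).
  move: jj; rewrite trN1 trN2 trN11 !(mul0r, mulr0, mulr1, mul1r, addr0, add0r).
  have -> : D * \sum_i P i * creal (B i i) +
      D * ((T ^+ 2 - \sum_i \sum_j P i * P j * creal (A i j * A j i)) / 2) =
     D * (T ^+ 2 / 2 - (\sum_i \sum_j P i * P j * creal (A i j * A j i)) / 2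
          + \sum_i P i * creal (B i i)) by rewrite [RHS]mulrDr mulrBl addrC.
  by apply: cjet_ext => t; rewrite !det_mulmx detdm.
by have [<- <- <-] := cjet_uniq jMt' jj.
Qed.

(** Expansion of the phase equation det(1 + i H(t)) = V(t) w with V real and w
    constant. Dividing by w, the imaginary parts of the coefficients vanish,
    which gives the linearised equation and its derivative; the real parts give
    the expansion of V. Here g is the inverse of the induced metric
    1 + H(0)^2. *)
Lemma phase_jets n (H : R -> 'M[R]_n.+1) (l : 'I_n.+1 -> R) (A B : 'M[R]_n.+1)
    (V : R -> R) (w : C) :
  w != 0 -> V 0 != 0 ->
  (\forall t \near (0 : R), \det (1%:M + imagC *: map_mx (@creal R) (H t)) = creal (V t) * w) ->
  (forall i j, jet (fun t => H t i j) (l i *+ (i == j)) (A i j) (B i j)) ->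
  let g i := (1 + l i ^+ 2)^-1 in
  let tau := \sum_i g i * l i * A i i in
  [/\ \sum_i g i * A i i = 0,
   \sum_i g i * B i i = (\sum_i \sum_j (l i + l j) * g i * g j * (A i j * A j i)) / 2 &
   jet V (V 0) (V 0 * tau) (V 0 * (tau ^+ 2 / 2
     - (\sum_i \sum_j (l i * l j - 1) * g i * g j * (A i j * A j i)) / 2
     + \sum_i g i * l i * B i i))].
Proof.
move=> wn0 V0 detE jH g tau.
pose P i : C := Complex (g i * l i) (g i).
have gn0 i : 1 + l i ^+ 2 != 0 by rewrite gt_eqF // ltr_pwDl // sqr_ge0.
have hP i : P i * (1 + imagC * creal (l i)) = imagC.
  apply: complex_ext; rewrite ?cReM ?cImM cReD cImD cReM cImM /= /g;
  by field; exact: gn0.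
have := cjet_det_diag hP jH; cbv zeta.
set D := \prod_i _; set T := \sum_i P i * creal (A i i).
set S := \sum_i \sum_j P i * P j * _; set Q := \sum_i P i * creal (B i i) => jd.
have jd' := cjetM (cjet_cst w^-1) jd.
have jV : cjet (fun t => creal (V t)) (w^-1 * D) (w^-1 * (D * T))
   (w^-1 * (D * (T ^+ 2 / 2 - S / 2 + Q))).
  case: jd'; rewrite !mul0r !addr0 => j1 j2.
  split; [apply: jet_ext j1 | apply: jet_ext j2]; apply: filterS detE => t ->;
    by rewrite mulrCA mulVf // mulr1.
have D0 : w^-1 * D = creal (V 0).
  case: jV => /jet_at0 e1 /jet_at0 e2.
  by apply: complex_ext; rewrite -?e1 -?e2.
have {}jV : cjet (fun t => creal (V t)) (creal (V 0)) (creal (V 0) * T)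
   (creal (V 0) * (T ^+ 2 / 2 - S / 2 + Q)) by rewrite -D0 -(mulrA _ D T) -(mulrA _ D _); exact: jV.
have ImSum (I : finType) (F : I -> C) : complex.Im (\sum_i F i) = \sum_i complex.Im (F i).
  by elim/big_rec2: _ => // i y x _ <-; rewrite cImD.
have ReSum (I : finType) (F : I -> C) : complex.Re (\sum_i F i) = \sum_i complex.Re (F i).
  by elim/big_rec2: _ => // i y x _ <-; rewrite cReD.
have ReP x (y : R) : complex.Re (x * creal y) = complex.Re x * y.
  by rewrite cReM /= mulr0 subr0.
have ImP x (y : R) : complex.Im (x * creal y) = complex.Im x * y.
  by rewrite cImM /= mulr0 add0r.
have [jr ji] := jV.
have [_ i1 i2] := jet_uniq ji (@jet_cst R 0).
have cV x : complex.Im (creal (V 0) * x) = V 0 * complex.Im x by rewrite mulrC ImP mulrC.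
have cVr x : complex.Re (creal (V 0) * x) = V 0 * complex.Re x by rewrite mulrC ReP mulrC.
have ImT : complex.Im T = 0.
  by move/eqP: i1; rewrite cV mulf_eq0 (negPf V0) /= => /eqP.
have h2 (x : C) : x / 2 = x * creal (2^-1).
  by rewrite /creal fmorphV rmorph_nat.
have ReT : complex.Re T = tau by rewrite ReSum; apply: eq_bigr => i _; rewrite ReP.
have T2 : T ^+ 2 = creal (tau ^+ 2).
  by rewrite crealX; congr (_ ^+ 2); apply: complex_ext; rewrite ?ReT ?ImT.
have ImS : complex.Im S = \sum_i \sum_j (l i + l j) * g i * g j * (A i j * A j i).
  rewrite ImSum; apply: eq_bigr => i _; rewrite ImSum; apply: eq_bigr => j _.
  by rewrite ImP cImM /=; congr (_ * _); ring.
have ReS : complex.Re S = \sum_i \sum_j (l i * l j - 1) * g i * g j * (A i j * A j i).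
  rewrite ReSum; apply: eq_bigr => i _; rewrite ReSum; apply: eq_bigr => j _.
  by rewrite ReP cReM /=; congr (_ * _); ring.
have cReB (x y : C) : complex.Re (x - y) = complex.Re x - complex.Re y.
  by case: x y => [? ?] [].
have cImB (x y : C) : complex.Im (x - y) = complex.Im x - complex.Im y.
  by case: x y => [? ?] [].
split.
- by rewrite -[RHS]ImT ImSum; apply: eq_bigr => i _; rewrite ImP.
- move/eqP: i2; rewrite cV mulf_eq0 (negPf V0) /= !h2 cImD cImB !ImP T2 /= mul0r sub0r ImS.
  rewrite addrC subr_eq0 ImSum => /eqP <-.
  by apply: eq_bigr => i _; rewrite ImP.
move: jr; rewrite !cVr ReT !h2 cReD cReB !ReP T2 ReS /=.
by congr (jet _ _ _ (_ * (_ + _))); rewrite ReSum; apply: eq_bigr => i _; rewrite ReP.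
Qed.

End DetJet.
Arguments imagC {R}.

(** * The Jacobi inequality and the algebra of the maximum point *)

Section Jacobi.
Variable R : realFieldType.

Lemma cauchy_schwarz n (a b : 'I_n -> R) :
  (\sum_i a i * b i) ^+ 2 <= (\sum_i a i ^+ 2) * (\sum_i b i ^+ 2).
Proof.
have H : 0 <= \sum_i \sum_j (a i * b j - a j * b i) ^+ 2.
  by apply: sumr_ge0 => i _; apply: sumr_ge0 => j _; exact: sqr_ge0.
have E : \sum_i \sum_j (a i * b j - a j * b i) ^+ 2 =
    2 * ((\sum_i a i ^+ 2) * (\sum_i b i ^+ 2)) - 2 * (\sum_i a i * b i) ^+ 2.
  have -> : \sum_i \sum_j (a i * b j - a j * b i) ^+ 2 =
     \sum_i (a i ^+ 2 * (\sum_j b j ^+ 2) + b i ^+ 2 * (\sum_j a j ^+ 2)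
       - 2 * (a i * b i * \sum_j a j * b j)).
    apply: eq_bigr => i _; rewrite !big_distrr /= -big_split /= -sumrB.
    by apply: eq_bigr => j _; ring.
  rewrite sumrB big_split /= -!big_distrr /= -!big_distrl /=; ring.
lra.
Qed.

Lemma sum_sqr_le n (x : 'I_n -> R) : (\sum_i x i) ^+ 2 <= n%:R * \sum_i x i ^+ 2.
Proof.
have := cauchy_schwarz (fun=> 1) x; rewrite expr1n sumr_const card_ord.
by rewrite (eq_bigr x) // => i _; rewrite mul1r.
Qed.

Lemma sum_swap_outer n (F : 'I_n -> 'I_n -> 'I_n -> R) :
  \sum_k \sum_a \sum_b F k a b = \sum_k \sum_a \sum_b F b a k.
Proof.
rewrite exchange_big [RHS]exchange_big /=; apply: eq_bigr => a _.
exact: exchange_big.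
Qed.

(** Jacobi inequality for convex solutions, tau and nu being the first two
    coefficients of V / V(x0) along the eigenvectors, U the third and B half the
    fourth derivatives of the solution. The right-hand sum is half the
    linearised operator applied to log V. The fourth derivatives are removed by
    the differentiated equation; after relabelling indices, thanks to the
    symmetry of U, what remains is half the sum of
    (1 + l_a l_b) g_a g_b g_k U_abk^2. For l nonnegative, keeping the terms
    with a = b and l_a^2 already controls the squared gradient. *)
Lemma jacobi_inequality n (l g : 'I_n -> R) (U : 'I_n -> 'I_n -> 'I_n -> R)
    (B : 'I_n -> 'I_n -> R) (tau nu : 'I_n -> R) :
  (forall i, 0 <= l i) -> (forall i, 0 <= g i) ->
  (forall a b k, U a b k = U b a k) -> (forall a b k, U a b k = U a k b) ->
  (forall k a, B k a = B a k) ->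
  (forall k, \sum_a g a * B k a =
     (\sum_a \sum_b (l a + l b) * g a * g b * U a b k ^+ 2) / 2) ->
  (forall k, tau k = \sum_a g a * l a * U a a k) ->
  (forall k, nu k = tau k ^+ 2 / 2
     - (\sum_a \sum_b (l a * l b - 1) * g a * g b * U a b k ^+ 2) / 2
     + \sum_a g a * l a * B k a) ->
  \sum_k g k * tau k ^+ 2 <= 2 * n%:R * \sum_k g k * (nu k - tau k ^+ 2 / 2).
Proof.
move=> l0 g0 U12 U23 BS hB htau hnu.
pose W a b k := g a * g b * g k * U a b k ^+ 2.
have W0 a b k : 0 <= W a b k.
  by apply: mulr_ge0; [do 2!apply: mulr_ge0 => // | exact: sqr_ge0].
have W12 a b k : W a b k = W b a k by rewrite /W (U12 a b); ring.
have W23 a b k : W a b k = W a k b by rewrite /W (U23 a b); ring.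
have E : \sum_k g k * (nu k - tau k ^+ 2 / 2) =
    (\sum_k \sum_a \sum_b (1 + l a * l b) * W a b k) / 2.
  (* The fourth derivatives, eliminated by the differentiated equation. *)
  have E1 : \sum_k g k * (\sum_a g a * l a * B k a) =
     (\sum_k \sum_a \sum_b (l k * l a) * W a b k) / 2 +
     (\sum_k \sum_a \sum_b (l k * l b) * W a b k) / 2.
    rewrite -mulrDl -big_split /=.
    transitivity (\sum_a g a * l a * \sum_k g k * B a k).
      transitivity (\sum_k \sum_a g k * (g a * l a * B k a)).
        by apply: eq_bigr => k _; rewrite big_distrr.
      rewrite exchange_big /=; apply: eq_bigr => a _.
      rewrite big_distrr /=; apply: eq_bigr => k _; rewrite BS; ring.
    rewrite big_distrl /=; apply: eq_bigr => k _; rewrite hB mulrA; congr (_ / 2).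
    rewrite -big_split big_distrr /=; apply: eq_bigr => a _.
    rewrite -big_split big_distrr /=; apply: eq_bigr => b _; rewrite /W /=; ring.
  have E2 : \sum_k \sum_a \sum_b (l k * l a) * W a b k =
            \sum_k \sum_a \sum_b (l a * l b) * W a b k.
    rewrite (sum_swap_outer (fun k a b => l k * l a * W a b k)).
    apply: eq_bigr => k _; apply: eq_bigr => a _; apply: eq_bigr => b _.
    by rewrite W23 [l b * _]mulrC.
  have E3 : \sum_k \sum_a \sum_b (l k * l b) * W a b k =
            \sum_k \sum_a \sum_b (l a * l b) * W a b k.
    rewrite -E2; apply: eq_bigr => k _; rewrite exchange_big /=.
    by apply: eq_bigr => a _; apply: eq_bigr => b _; rewrite W12.
  transitivity (- ((\sum_k \sum_a \sum_b (l a * l b) * W a b k) / 2) +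
     (\sum_k \sum_a \sum_b W a b k) / 2 + \sum_k g k * (\sum_a g a * l a * B k a)).
    rewrite -mulNr -mulrDl -sumrN -big_split /= big_distrl -big_split /=.
    apply: eq_bigr => k _; rewrite hnu.
    have -> : \sum_a \sum_b (l a * l b - 1) * g a * g b * U a b k ^+ 2 =
      \sum_a \sum_b (l a * l b) * g a * g b * U a b k ^+ 2 -
      \sum_a \sum_b g a * g b * U a b k ^+ 2.
      rewrite -sumrB; apply: eq_bigr => a _; rewrite -sumrB; apply: eq_bigr => b _; ring.
    have -> : \sum_a \sum_b l a * l b * W a b k =
       g k * \sum_a \sum_b (l a * l b) * g a * g b * U a b k ^+ 2.
      rewrite big_distrr; apply: eq_bigr => a _; rewrite big_distrr; apply: eq_bigr => b _.
      by rewrite /W /=; ring.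
    have -> : \sum_a \sum_b W a b k = g k * \sum_a \sum_b g a * g b * U a b k ^+ 2.
      rewrite big_distrr; apply: eq_bigr => a _; rewrite big_distrr; apply: eq_bigr => b _.
      by rewrite /W /=; ring.
    by field.
  rewrite E1 E2 E3.
  have -> : \sum_k \sum_a \sum_b (1 + l a * l b) * W a b k =
     \sum_k \sum_a \sum_b W a b k + \sum_k \sum_a \sum_b (l a * l b) * W a b k.
    rewrite -big_split; apply: eq_bigr => k _; rewrite -big_split; apply: eq_bigr => a _.
    by rewrite -big_split; apply: eq_bigr => b _; rewrite mulrDl mul1r.
  by field.
rewrite E.
have -> : 2 * n%:R * ((\sum_k \sum_a \sum_b (1 + l a * l b) * W a b k) / 2) =
   \sum_k n%:R * (\sum_a \sum_b (1 + l a * l b) * W a b k).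
  by rewrite -big_distrr /=; field.
apply: ler_sum => k _.
apply: (@le_trans _ _ (g k * (n%:R * \sum_a (g a * l a * U a a k) ^+ 2))).
  by rewrite ler_wpM2l // htau sum_sqr_le.
rewrite mulrCA ler_wpM2l // big_distrr /=; apply: ler_sum => a _.
rewrite (bigD1 a) //= -[leLHS]addr0 lerD //; last first.
  apply: sumr_ge0 => b _; apply: mulr_ge0 => //.
  by rewrite addr_ge0 // mulr_ge0.
rewrite mulrDl mul1r -[leLHS]add0r lerD // le_eqVlt; apply/orP; left; apply/eqP.
rewrite /W; ring.
Qed.

(** At an interior maximum of V h^M, with h having normalised coefficients eta
    and zeta, log V has gradient - M eta; a Jacobi inequality with constant n
    then forces the operator applied to h to be nonpositive once M is at least
    n. *)
Lemma weighted_max_inequality n (g tau nu eta zeta : 'I_n -> R) (M : R) :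
  0 < n%:R :> R -> n%:R <= M -> (forall i, 0 <= g i) ->
  (forall k, tau k + M * eta k = 0) ->
  (forall k, nu k + M * (tau k * eta k) + (M * zeta k + M * (M - 1) / 2 * eta k ^+ 2) <= 0) ->
  \sum_k g k * tau k ^+ 2 <= 2 * n%:R * \sum_k g k * (nu k - tau k ^+ 2 / 2) ->
  \sum_k g k * zeta k <= 0.
Proof.
move=> n0 nM g0 h1 h2 hJ.
have M0 : 0 < M by exact: lt_le_trans nM.
set Z := \sum_k g k * zeta k; pose E := \sum_k g k * eta k ^+ 2.
have E0 : 0 <= E by apply: sumr_ge0 => k _; rewrite mulr_ge0 ?sqr_ge0.
have tauE k : tau k = - (M * eta k) by move: (h1 k) => /eqP; rewrite addr_eq0 => /eqP.
have T : \sum_k g k * tau k ^+ 2 = M ^+ 2 * E.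
  by rewrite big_distrr /=; apply: eq_bigr => k _; rewrite tauE; ring.
have N : \sum_k g k * (nu k - tau k ^+ 2 / 2) <= - (M * Z) + M / 2 * E.
  rewrite /Z /E !big_distrr /= -sumrN -big_split /=; apply: ler_sum => k _.
  have -> : - (M * (g k * zeta k)) + M / 2 * (g k * eta k ^+ 2) =
     g k * (- (M * zeta k) + M / 2 * eta k ^+ 2) by ring.
  apply: ler_wpM2l => //; have := h2 k; rewrite tauE => h.
  rewrite -subr_ge0.
  have -> : - (M * zeta k) + M / 2 * eta k ^+ 2 - (nu k - (- (M * eta k)) ^+ 2 / 2) =
    - (nu k + M * (- (M * eta k) * eta k) + (M * zeta k + M * (M - 1) / 2 * eta k ^+ 2)).
    by field.
  by rewrite oppr_ge0.
have H : M ^+ 2 * E <= 2 * n%:R * (- (M * Z) + M / 2 * E).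
  by rewrite -T; apply: (le_trans hJ); rewrite ler_wpM2l // mulr_ge0 // ltW.
have H2 : 2 * n%:R * M * Z <= - ((M - n%:R) * (M * E)).
  rewrite -subr_ge0.
  have -> : - ((M - n%:R) * (M * E)) - 2 * n%:R * M * Z =
    2 * n%:R * (- (M * Z) + M / 2 * E) - M ^+ 2 * E by field.
  by rewrite subr_ge0.
have H3 : 2 * n%:R * M * Z <= 0.
  by apply: (le_trans H2); rewrite oppr_le0 !mulr_ge0 ?subr_ge0 // ltW.
have P : 0 < 2 * n%:R * M by rewrite !mulr_gt0.
by rewrite -(pmulr_rle0 Z P).
Qed.

(** For h = exp(- kap s) - const and s the twisted squared distance, the second
    derivatives of h contribute 2 kap times its squared gradient, which is at
    least the squared length of z because (K + l)^2 >= 1 + l^2. The only term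
    with the wrong sign is bounded by n (K^2 + 1), whatever the size of l. The
    terms q, containing third derivatives, sum to zero by the linearised
    equation. *)
Lemma barrier_subsolution n (g l z q s1 s2 zeta : 'I_n -> R) (K kap e h0 : R) :
  (forall i, g i = (1 + l i ^+ 2)^-1) -> (forall i, 0 <= l i) -> 1 <= K ->
  0 < kap -> 0 < e -> 0 < h0 ->
  (forall k, s1 k = 2 * ((K + l k) * z k)) ->
  (forall k, s2 k = (K + l k) ^+ 2 + q k) -> \sum_k g k * q k = 0 ->
  (forall k, h0 * zeta k = e * (- kap * s2 k + (- kap * s1 k) ^+ 2 / 2)) ->
  n%:R * (K ^+ 2 + 1) < 2 * kap * \sum_k z k ^+ 2 ->
  0 < \sum_k g k * zeta k.
Proof.
move=> hg l0 K1 kap0 e0 h00 hs1 hs2 hq hz hk.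
have p0 i : 0 < 1 + l i ^+ 2 by rewrite ltr_pwDl // sqr_ge0.
have g0 i : 0 < g i by rewrite hg invr_gt0.
have lo i : 1 <= g i * (K + l i) ^+ 2.
  rewrite hg mulrC ler_pdivlMr // mul1r.
  have := l0 i; move: (l i) => x x0; nra.
have hi i : g i * (K + l i) ^+ 2 <= K ^+ 2 + 1.
  rewrite hg mulrC ler_pdivrMr //.
  rewrite -subr_ge0 (_ : _ - _ = (K * l i - 1) ^+ 2); last by ring.
  exact: sqr_ge0.
rewrite -(pmulr_rgt0 _ h00).
have -> : h0 * \sum_k g k * zeta k = e * kap * (2 * kap * (\sum_k g k * (K + l k) ^+ 2 * z k ^+ 2)
   - \sum_k g k * (K + l k) ^+ 2 - \sum_k g k * q k).
  rewrite !big_distrr /= -!sumrB big_distrr /=; apply: eq_bigr => k _.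
  by rewrite mulrCA hz hs1 hs2; field.
rewrite hq subr0 !mulr_gt0 // subr_gt0.
apply: (@le_lt_trans _ _ (n%:R * (K ^+ 2 + 1))).
  rewrite -[n in n%:R]card_ord mulr_natl -sumr_const; apply: ler_sum => k _; exact: hi.
apply: (lt_le_trans hk); rewrite ler_wpM2l ?mulr_ge0 ?(ltW kap0) //.
by apply: ler_sum => k _; rewrite ler_peMl ?sqr_ge0.
Qed.

End Jacobi.

(** * Euclidean balls and convex functions *)

Lemma continuous_ed (R : realType) (V : normedModType R) (f : V -> R) (x : V) :
  (forall e : R, 0 < e -> exists2 d : R, 0 < d &
     forall z, `|x - z| < d -> `|f x - f z| < e) -> {for x, continuous f}.
Proof.
move=> H; apply/cvgrPdist_lt => e e0; have [d d0 hd] := H e e0.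
by apply/nbhs_ballP; exists d => // z; rewrite -ball_normE /=; exact: hd.
Qed.

Section Euclid.
Variables (R : realType) (n : nat).
Implicit Types x y v : 'rV[R]_n.

Lemma enorm_ge0 x : 0 <= enorm x. Proof. exact: sqrtr_ge0. Qed.

Lemma enorm_sqr x : enorm x ^+ 2 = \sum_i x ord0 i ^+ 2.
Proof. by rewrite sqr_sqrtr // sumr_ge0 // => i _; exact: sqr_ge0. Qed.

Lemma enorm0 : enorm (0 : 'rV[R]_n) = 0.
Proof. by rewrite /enorm big1 ?sqrtr0 // => i _; rewrite mxE expr0n. Qed.

Lemma enormN x : enorm (- x) = enorm x.
Proof. by congr Num.sqrt; apply: eq_bigr => i _; rewrite mxE sqrrN. Qed.

Lemma enormZ (t : R) x : enorm (t *: x) = `|t| * enorm x.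
Proof.
rewrite /enorm -sqrtr_sqr -sqrtrM ?sqr_ge0 // big_distrr /=; congr Num.sqrt.
by apply: eq_bigr => i _; rewrite mxE exprMn.
Qed.

Lemma enormD x y : enorm (x + y) <= enorm x + enorm y.
Proof.
rewrite -(@ler_pXn2r _ 2) ?nnegrE ?addr_ge0 ?enorm_ge0 //.
rewrite sqrrD !enorm_sqr.
have -> : \sum_i (x + y) ord0 i ^+ 2 = \sum_i x ord0 i ^+ 2 +
   (\sum_i x ord0 i * y ord0 i) *+ 2 + \sum_i y ord0 i ^+ 2.
  by rewrite -sumrMnl -!big_split; apply: eq_bigr => i _; rewrite mxE sqrrD.
rewrite lerD2r lerD2l ler_pMn2r //.
apply: (le_trans (ler_norm _)).
rewrite -(@ler_pXn2r _ 2) ?nnegrE ?mulr_ge0 ?enorm_ge0 //.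
by rewrite real_normK ?num_real // exprMn !enorm_sqr cauchy_schwarz.
Qed.

Lemma coord_le_enorm x i : `|x ord0 i| <= enorm x.
Proof.
rewrite -(@ler_pXn2r _ 2) ?nnegrE ?enorm_ge0 // real_normK ?num_real // enorm_sqr.
by rewrite (bigD1 i) //= lerDl sumr_ge0 // => j _; exact: sqr_ge0.
Qed.

Lemma coord_le_norm x i : `|x ord0 i| <= `|x|.
Proof.
rewrite [leRHS]/Num.Def.normr /= mx_normrE.
exact: (@le_bigmax _ _ _ 0 (fun ij : 'I_1 * 'I_n => `|x ij.1 ij.2|) (ord0, i)).
Qed.

Lemma norm_le_enorm x : `|x| <= enorm x.
Proof.
rewrite [leLHS]/Num.Def.normr /= mx_normrE; apply: bigmax_le; first exact: enorm_ge0.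
by move=> [i j] _ /=; rewrite (ord1 i); exact: coord_le_enorm.
Qed.

Lemma enorm_le_norm x : enorm x <= n%:R * `|x|.
Proof.
rewrite -(@ler_pXn2r _ 2) ?nnegrE ?mulr_ge0 ?enorm_ge0 // enorm_sqr.
apply: (@le_trans _ _ (\sum_(i < n) `|x| ^+ 2)).
  apply: ler_sum => i _; rewrite -real_normK ?num_real //.
  by rewrite ler_pXn2r ?nnegrE // coord_le_norm.
rewrite sumr_const card_ord -[leLHS]mulr_natl exprMn ler_wpM2r ?sqr_ge0 //.
by rewrite -natrX ler_nat; case: (n) => // m; rewrite leq_pmulr.
Qed.

Lemma enorm_continuous y : continuous (fun x => enorm (x - y)).
Proof.
move=> x; apply: continuous_ed => e e0.
have n0 : 0 < n%:R + 1 :> R by rewrite ltr_wpDl.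
have d0 : 0 < e / (n%:R + 1) by rewrite divr_gt0.
exists (e / (n%:R + 1)) => // z xz.
have H : enorm (x - z) < e.
  apply: (le_lt_trans (enorm_le_norm _)).
  apply: (@le_lt_trans _ _ ((n%:R + 1) * `|x - z|)).
    by rewrite ler_wpM2r // lerDl.
  by rewrite mulrC -ltr_pdivlMr.
rewrite ltr_norml; apply/andP; split.
  have := enormD (x - y) (z - x).
  rewrite addrAC addrCA subrr addr0 -(enormN (z - x)) opprB; lra.
have := enormD (z - y) (x - z).
by rewrite addrAC addrCA subrr addr0; lra.
Qed.

Lemma eball_open y (r : R) : open (eball y r).
Proof.
have -> : eball y r = (fun x => enorm (x - y)) @^-1` [set t | t < r] by [].
apply: open_comp; last exact: open_lt.
by move=> x _; exact: enorm_continuous.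
Qed.

Definition cball y (r : R) : set 'rV[R]_n := [set x | enorm (x - y) <= r].

Lemma cball_compact y (r : R) : compact (cball y r).
Proof.
apply: bounded_closed_compact.
  exists (enorm y + r); split; first exact: num_real.
  move=> M hM x xr /=; apply: (le_trans (norm_le_enorm _)).
  rewrite -(subrK y x); apply: (le_trans (enormD _ _)); apply: ltW.
  by rewrite addrC; apply: le_lt_trans hM; rewrite lerD2l.
have -> : cball y r = (fun x => enorm (x - y)) @^-1` [set t | t <= r] by [].
apply: preimage_closed; last exact: closed_le.
by move=> x _; exact: enorm_continuous.
Qed.

End Euclid.

Section Convex.
Variables (R : realType) (n : nat) (u : 'rV[R]_n -> R).
Let U : set 'rV[R]_n := eball 0 2.
Hypothesis su : smooth_on U u.
Hypothesis cu : convex_function U u.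

Let oU : open U. Proof. exact: eball_open. Qed.

Lemma convexE (t : R) x y : 0 <= t -> t <= 1 -> U x -> U y ->
  u (t *: x + (1 - t) *: y) <= t * u x + (1 - t) * u y.
Proof.
move=> t0 t1 Ux Uy.
by have := cu (Itv01 t0 t1) (mem_set Ux) (mem_set Uy).
Qed.

(** Compare the difference quotient of u at y towards x for small steps with
    the convexity inequality. *)
Lemma convex_gradient x y : U x -> U y -> u y + 'D_(x - y) u y <= u x.
Proof.
move=> Ux Uy; rewrite -lerBrDl; apply/ler_addgt0Pr => e e0.
have /is_deriveP/(_ e e0)[r /= r0 hr] := derivableP (@derivable_smooth _ _ _ oU u y (x - y) su Uy).
pose h := Num.min 1 (r / 2).
have h0 : 0 < h by rewrite lt_min ltr01 divr_gt0.
have hrr : `|h| < r by rewrite gtr0_norm // (@le_lt_trans _ _ (r / 2)) ?ge_min ?lexx ?orbT //; lra.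
have := hr h; rewrite /= sub0r normrN => /(_ hrr).
rewrite ler_norml => /andP[+ _]; rewrite (gtr0_norm h0) => H.
have h1 : h <= 1 by rewrite ge_min lexx.
have := convexE (ltW h0) h1 Ux Uy.
have -> : h *: x + (1 - h) *: y = y + h *: (x - y).
  by rewrite scalerBl scalerBr scale1r addrCA.
move=> H2; rewrite -(ler_pM2l h0); lra.
Qed.

Lemma convex_monotone x y : U x -> U y -> 'D_(x - y) u y <= 'D_(x - y) u x.
Proof.
move=> Ux Uy; have := convex_gradient Ux Uy; have := convex_gradient Uy Ux.
have -> : 'D_(y - x) u x = - 'D_(x - y) u x.
  rewrite !(derive_smooth oU _ su Ux) -sumrN; apply: eq_bigr => i _.
  by rewrite !mxE -mulNr opprB.
lra.
Qed.

(** The midpoint inequality says that - u(x + t v) - u(x - t v) is maximal at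
    t = 0. *)
Lemma convex_second x v : U x -> 0 <= 'D_v ('D_v u) x.
Proof.
move=> Ux; have j1 := jet_smooth_line oU v su Ux.
have j2 := jet_comp0 j1 (@jet_opp R).
have Ut (w : 'rV[R]_n) : \forall t \near (0 : R), U (x + t *: w).
  by apply: near_line; exact: open_nbhs_nbhs.
have [] := jet_max (jetN (jetD j1 j2)).
  near=> t.
  have U1 : U (x + t *: v) by near: t; exact: Ut.
  have U2 : U (x + - t *: v).
    by rewrite scaleNr -scalerN; near: t; exact: Ut.
  have := convexE (t := 2^-1) _ _ U1 U2.
  have -> : 2^-1 *: (x + t *: v) + (1 - 2^-1) *: (x + - t *: v) = x.
    by apply/matrixP => i j; rewrite !mxE; field.
  rewrite lerN2 invr_ge0 ler0n => /(_ isT) H.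
  have := H _; have -> : (2^-1 <= 1 :> R) by lra.
  by move=> /(_ isT); lra.
by move=> _; rewrite oppr_le0 sqrrN expr1n mulr0; lra.
Unshelve. all: by end_near. Qed.

End Convex.

(** * Continuity on balls and the gradient bound *)

Section ContinuousAt.
Variables (R : realType) (V : normedModType R) (x : V).

Lemma continuous_at_sum (I : Type) (r : seq I) (F : I -> V -> R) :
  (forall i, {for x, continuous (F i)}) ->
  {for x, continuous (fun y => \sum_(i <- r) F i y)}.
Proof.
move=> cF; elim: r => [|i r IH].
  rewrite (_ : (fun _ => _) = cst 0); first exact: cst_continuous.
  by apply/funext => z; rewrite big_nil.
rewrite (_ : (fun _ => _) = (fun y => F i y + \sum_(i <- r) F i y)); last first.
  by apply/funext => z; rewrite big_cons.
by apply: continuousD => //; exact: cF.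
Qed.

Lemma continuous_at_prod (I : Type) (r : seq I) (F : I -> V -> R) :
  (forall i, {for x, continuous (F i)}) ->
  {for x, continuous (fun y => \prod_(i <- r) F i y)}.
Proof.
move=> cF; elim: r => [|i r IH].
  rewrite (_ : (fun _ => _) = cst 1); first exact: cst_continuous.
  by apply/funext => z; rewrite big_nil.
rewrite (_ : (fun _ => _) = (fun y => F i y * \prod_(i <- r) F i y)); last first.
  by apply/funext => z; rewrite big_cons.
by apply: continuousM => //; exact: cF.
Qed.

Lemma continuous_at_exp (f : V -> R) m : {for x, continuous f} ->
  {for x, continuous (fun y => f y ^+ m)}.
Proof.
move=> cf; elim: m => [|m IH].
  rewrite (_ : (fun _ => _) = cst 1); first exact: cst_continuous.
  by apply/funext => z; rewrite expr0.
rewrite (_ : (fun _ => _) = (fun y => f y * f y ^+ m)); last first.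
  by apply/funext => z; rewrite exprS.
exact: continuousM.
Qed.

Lemma continuous_at_det n (M : V -> 'M[R]_n) :
  (forall i j, {for x, continuous (fun y => M y i j)}) ->
  {for x, continuous (fun y => \det (M y))}.
Proof.
move=> cM; apply: continuous_at_sum => s; apply: continuousM; first exact: cst_continuous.
by apply: continuous_at_prod => i; exact: cM.
Qed.

Lemma continuous_at_comp (f : V -> R) (g : R -> R) : {for x, continuous f} ->
  continuous g -> {for x, continuous (fun y => g (f y))}.
Proof. by move=> cf cg; apply: continuous_comp => //; exact: cg. Qed.

End ContinuousAt.

Section Bounds.
Variables (R : realType) (n : nat).
Implicit Types (x y : 'rV[R]_n) (u : 'rV[R]_n -> R).

Lemma cball_max (f : 'rV[R]_n -> R) y r : 0 <= r ->
  (forall x, cball y r x -> {for x, continuous f}) ->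
  exists2 x0, cball y r x0 & forall x, cball y r x -> f x <= f x0.
Proof.
move=> r0 cf.
have [||x0 x0A H] := @compact_EVT_max _ _ f (cball y r) _ (@cball_compact _ _ y r).
- by exists y; rewrite /cball /= subrr enorm0.
- by apply: continuous_in_subspaceT => x xA; apply: cf; exact: set_mem.
exists x0; first exact: set_mem.
by move=> x xA; apply: H; exact: mem_set.
Qed.

Lemma cball_bounded (f : 'rV[R]_n -> R) y r : 0 <= r ->
  (forall x, cball y r x -> {for x, continuous f}) ->
  exists2 G : R, 0 <= G & forall x, cball y r x -> `|f x| <= G.
Proof.
move=> r0 cf.
have [|x0 _ H] := @cball_max (fun x => `|f x|) y r r0.
  by move=> x xA; apply: continuous_at_comp; [exact: cf | exact: norm_continuous].
by exists `|f x0|.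
Qed.

Lemma cball_sub_eball y (r s t : R) : eball 0 s y -> r + s <= t ->
  cball y r `<=` eball 0 t.
Proof.
move=> ys rst x; rewrite /cball /eball /= subr0 => xr.
have := enormD (x - y) y; rewrite subrK.
move: ys; rewrite /eball /= subr0; lra.
Qed.

Lemma eball_sub_cball y (r : R) : eball y r `<=` cball y r.
Proof. by move=> x /ltW. Qed.

Lemma eball_center y (r : R) : 0 < r -> eball y r y.
Proof. by rewrite /eball /= subrr enorm0. Qed.

Lemma mxnorm_ge0 (A : 'M[R]_n) : 0 <= mxnorm A. Proof. exact: sqrtr_ge0. Qed.

Lemma hessian_continuous (U : set 'rV[R]_n) u x i j : smooth_on U u -> U x ->
  {for x, continuous (fun y => hessian u y i j)}.
Proof.
move=> su Ux; rewrite (_ : (fun _ => _) = pderiv i (pderiv j u)); last first.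
  by apply/funext => y; rewrite mxE.
exact: (smooth_continuous (smooth_on_pderiv i (smooth_on_pderiv j su)) Ux).
Qed.

Lemma mxnorm_hessian_continuous (U : set 'rV[R]_n) u x : smooth_on U u -> U x ->
  {for x, continuous (fun y => mxnorm (hessian u y))}.
Proof.
move=> su Ux; apply: continuous_at_comp; last exact: sqrt_continuous.
apply: continuous_at_sum => i; apply: continuous_at_sum => j.
by apply: continuous_at_exp; exact: hessian_continuous su Ux.
Qed.

Lemma slag_V_hessian_continuous (U : set 'rV[R]_n) u x : smooth_on U u -> U x ->
  {for x, continuous (fun y => slag_V (hessian u y))}.
Proof.
move=> su Ux; apply: continuous_at_comp; last exact: sqrt_continuous.
apply: continuous_at_det => i j.
rewrite (_ : (fun _ => _) = (fun y => (1%:M : 'M[R]_n) i j +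
   \sum_k hessian u y i k * hessian u y k j)); last first.
  by apply/funext => y; rewrite [LHS]mxE [X in _ + X]mxE.
apply: continuousD; first exact: cst_continuous.
apply: continuous_at_sum => k; apply: continuousM; exact: hessian_continuous su Ux.
Qed.

Lemma sup_on_ub (A : set 'rV[R]_n) f x : A x -> ((f x)%:E <= sup_on A f)%E.
Proof. by move=> Ax; apply: ereal_sup_ubound; exists x. Qed.

Lemma sup_on_le (A : set 'rV[R]_n) f (M : \bar R) :
  (forall x, A x -> ((f x)%:E <= M)%E) -> (sup_on A f <= M)%E.
Proof. by move=> H; apply: ge_ereal_sup => _ [x Ax <-]; exact: H. Qed.

Lemma sup_on_fin (A : set 'rV[R]_n) f (G : R) x : A x ->
  (forall x, A x -> f x <= G) -> sup_on A f \is a fin_num.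
Proof.
move=> Ax H; rewrite fin_numE; apply/andP; split.
  by rewrite -ltNye (@lt_le_trans _ _ (f x)%:E) ?ltNyr ?sup_on_ub.
rewrite -ltey; apply: (@le_lt_trans _ _ G%:E); last exact: ltry.
by apply: sup_on_le => z Az; rewrite lee_fin H.
Qed.

End Bounds.

Section GradientBound.
Variables (R : realType) (n : nat) (u : 'rV[R]_n -> R).
Hypothesis n0 : (0 < n)%N.
Let U : set 'rV[R]_n := eball 0 2.
Hypothesis su : smooth_on U u.
Hypothesis cu : convex_function U u.

Let oU : open U. Proof. exact: eball_open. Qed.

Let B1U : cball (0 : 'rV[R]_n) 1 `<=` U.
Proof.
by move=> x; rewrite /cball /U /eball /= => h; apply: (le_lt_trans h); rewrite ltr1n.
Qed.

(** The norm takes values in the extended reals, so its finiteness must come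
    first: the gradient is bounded on the compact unit ball and the gradient
    inequality for convex functions turns this into a Lipschitz bound. Then
    difference quotients along the axes bound the partial derivatives by the
    Lipschitz constant. *)
Lemma gradient_bound : let N := fine (C01_norm (eball 0 1) u) in
  0 <= N /\ forall x i, eball 0 1 x -> `|pderiv i u x| <= N.
Proof.
have bu : exists2 G : R, 0 <= G & forall x, cball 0 1 x -> `|u x| <= G.
  by apply: cball_bounded => // x /B1U; exact: smooth_continuous.
have bd : forall i, exists G : R, 0 <= G /\ forall x, cball 0 1 x -> `|pderiv i u x| <= G.
  move=> i; have [|G ? ?] := @cball_bounded _ _ (pderiv i u) 0 1 ler01; last by exists G.
  by move=> x /B1U; apply: smooth_continuous; exact: smooth_on_pderiv.
have [G0 G00 G0P] := bu; have [G GP] := choice bd.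
pose L := \sum_i G i.
have Dle x v : cball 0 1 x -> 'D_v u x <= L * enorm v.
  move=> xB; rewrite (derive_smooth oU) //; last exact: B1U.
  rewrite /L big_distrl /=; apply: ler_sum => i _.
  apply: (le_trans (ler_norm _)); rewrite normrM mulrC.
  by apply: ler_pM => //; [exact: (GP i).2 | exact: coord_le_enorm].
have lip x y : eball 0 1 x -> eball 0 1 y -> u x - u y <= L * enorm (x - y).
  move=> /eball_sub_cball xB /eball_sub_cball yB.
  have := convex_gradient su cu (B1U yB) (B1U xB).
  have := Dle x (y - x) xB; rewrite -(enormN (y - x)) opprB => h1 h2.
  have -> : u x - u y = - (u y - u x) by ring.
  have h3 : 'D_(y - x) u x = - 'D_(x - y) u x.
    rewrite !(derive_smooth oU _ su (B1U xB)) -sumrN; apply: eq_bigr => i _.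
    by rewrite !mxE -mulNr opprB.
  have := Dle x (x - y) xB; rewrite h3 in h2 *; lra.
have lipn x y : eball 0 1 x -> eball 0 1 y -> `|u x - u y| <= L * enorm (x - y).
  move=> xB yB; rewrite ler_norml lip // andbT lerNl opprB.
  by rewrite -(enormN (x - y)) opprB; exact: lip.
pose Bp := [set p : 'rV[R]_n * 'rV[R]_n | eball 0 1 p.1 /\ eball 0 1 p.2 /\ p.1 <> p.2].
have enpos (p : 'rV[R]_n * 'rV[R]_n) : p.1 <> p.2 -> 0 < enorm (p.1 - p.2).
  move=> pn; rewrite lt_def enorm_ge0 andbT; apply/eqP => e0; apply: pn.
  apply/eqP; rewrite -subr_eq0 -normr_le0 -e0; exact: norm_le_enorm.
have qle p : Bp p -> `|u p.1 - u p.2| / enorm (p.1 - p.2) <= L.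
  by move=> [p1 [p2 pn]]; rewrite ler_pdivrMr ?enpos // lipn.
(* Two distinct points of the ball: the supremum of an empty family would be
   minus infinity. *)
pose e1 : 'rV[R]_n := 2^-1 *: delta_mx ord0 (Ordinal n0).
have e1n : enorm e1 = 2^-1.
  rewrite /e1 enormZ gtr0_norm ?invr_gt0 // /enorm (bigD1 (Ordinal n0)) //= big1.
    by rewrite mxE !eqxx addr0 expr1n sqrtr1 mulr1.
  by move=> i /negPf ni; rewrite mxE ni andbF expr0n.
have e1B : eball 0 1 e1 by rewrite /eball /= subr0 e1n; lra.
have e1p : Bp (e1, 0).
  split => //=; split; first exact: eball_center.
  by move=> h; move: e1n; rewrite h enorm0 => /esym/eqP; rewrite invr_eq0 pnatr_eq0.
pose Sl := lipschitz_seminorm (eball 0 1) u.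
have Sl_ub p : Bp p -> ((`|u p.1 - u p.2| / enorm (p.1 - p.2))%:E <= Sl)%E.
  by move=> pB; apply: ereal_sup_ubound; exists p.
have Sl_le : (Sl <= L%:E)%E.
  by apply: ge_ereal_sup => _ [p pB <-]; rewrite lee_fin qle.
have Slf : Sl \is a fin_num.
  rewrite fin_numE; apply/andP; split.
    rewrite -ltNye; apply: lt_le_trans (Sl_ub _ e1p); exact: ltNyr.
  rewrite -ltey; apply: (le_lt_trans Sl_le); exact: ltry.
pose Su := sup_on (eball 0 1) (fun x => `|u x|%R).
have c0 : eball 0 1 (0 : 'rV[R]_n) by exact: eball_center.
have Suf : Su \is a fin_num.
  by apply: (sup_on_fin (G := G0) c0) => x /eball_sub_cball; exact: G0P.
have Su0 : 0 <= fine Su.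
  apply: fine_ge0; apply: le_trans (sup_on_ub _ c0); exact: normr_ge0.
have NE : fine (C01_norm (eball 0 1) u) = fine Su + fine Sl by rewrite fineD.
have lipS p : Bp p -> `|u p.1 - u p.2| / enorm (p.1 - p.2) <= fine Sl.
  by move=> pB; rewrite -lee_fin fineK // Sl_ub.
rewrite NE /=; set N := fine Su + fine Sl.
have SlN : fine Sl <= N by rewrite lerDr.
have N0 : 0 <= N.
  apply: le_trans SlN; apply: le_trans (lipS _ e1p).
  by rewrite divr_ge0 ?enorm_ge0.
split=> // x i xB.
apply/ler_addgt0Pr => e e0.
have Ux : U x by apply/B1U/eball_sub_cball.
have [_ /(_ i) dx] := su [::] Ux.
have /is_deriveP/(_ e e0) hd := derivableP dx.
have hB : \forall h \near (0 : R), eball 0 1 (x + h *: delta_mx ord0 i).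
  by apply: near_line; apply: open_nbhs_nbhs; split => //; exact: eball_open.
have [r /= r0 hr] := filterI hd hB.
have r20 : 0 < r / 2 by rewrite divr_gt0.
have := hr (r / 2); rewrite /= sub0r normrN (gtr0_norm r20).
have -> : r / 2 < r by lra.
move=> /(_ isT) [h1 h2].
have en : enorm (delta_mx ord0 i : 'rV[R]_n) = 1.
  rewrite /enorm (bigD1 i) //= big1; first by rewrite mxE !eqxx addr0 expr1n sqrtr1.
  by move=> j /negPf ni; rewrite mxE ni andbF expr0n.
have ne : x + r / 2 *: delta_mx ord0 i - x = r / 2 *: delta_mx ord0 i.
  by rewrite addrAC subrr add0r.
have pB : Bp (x + r / 2 *: delta_mx ord0 i, x).
  split=> //=; split=> // h; have := enormZ (r / 2) (delta_mx ord0 i : 'rV[R]_n).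
  rewrite -ne h subrr enorm0 en mulr1 gtr0_norm // => /eqP.
  by rewrite lt_eqF.
have := lipS _ pB; rewrite /= ne enormZ en mulr1 (gtr0_norm r20) ler_pdivrMr // => h3.
rewrite -(ler_pM2r r20); rewrite -/(pderiv i u x) in h1.
have -> : `|pderiv i u x| * (r / 2) = `|r / 2 * pderiv i u x|.
  by rewrite normrM (gtr0_norm r20) mulrC.
have -> : r / 2 * pderiv i u x = (u (x + r / 2 *: delta_mx ord0 i) - u x) -
   (u (x + r / 2 *: delta_mx ord0 i) - u x - r / 2 * pderiv i u x) by ring.
apply: (le_trans (ler_normB _ _)); rewrite mulrDl; apply: lerD; last exact: h1.
by apply: (le_trans h3); rewrite ler_wpM2r // ltW.
Qed.

End GradientBound.

(** * The volume element and the phase of a symmetric matrix *)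

Section DetEig.

Lemma det_1pZ_eigen (K : fieldType) n (A : 'M[K]_n) (lam : 'I_n -> K) (c : K) :
  char_poly A = \prod_(i < n) ('X - (lam i)%:P) ->
  \det (1%:M + c *: A) = \prod_i (1 + c * lam i).
Proof.
move=> chA; have [->|cn0] := eqVneq c 0.
  by rewrite scale0r addr0 det1 big1 // => i _; rewrite mul0r addr0.
have -> : 1%:M + c *: A = (- c) *: ((- c^-1)%:M - A).
  by rewrite scalerBr scale_scalar_mx mulrNN divff // scaleNr opprK.
have -> : \prod_i (1 + c * lam i) = \prod_i ((- c) * ((- c^-1) - lam i)).
  by apply: eq_bigr => i _; rewrite mulrBr mulrNN divff // mulNr opprK.
rewrite detZ big_split /= prodr_const card_ord; congr (_ * _).
by rewrite -horner_char_poly chA horner_prod; apply: eq_bigr => i _; rewrite hornerXsubC.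
Qed.

Variable R : realType.
Local Notation C := (R[i]).

(** The complex exponential of i t. *)
Definition cis (t : R) : C := Complex (cos t) (sin t).

Lemma cisD (s t : R) : cis (s + t) = cis s * cis t.
Proof.
by apply: complex_ext; rewrite ?cReM ?cImM /= ?cosD ?sinD // addrC [cos s * _]mulrC mulrC.
Qed.

Lemma cis_neq0 t : cis t != 0.
Proof.
apply/eqP => h; have := cos2Dsin2 t.
have -> : cos t = 0 by rewrite -[LHS]/(complex.Re (cis t)) h.
have -> : sin t = 0 by rewrite -[LHS]/(complex.Im (cis t)) h.
by move/eqP; rewrite expr0n /= addr0 eq_sym oner_eq0.
Qed.

Lemma one_pi_cis (l : R) : 1 + imagC * creal l = creal (Num.sqrt (1 + l ^+ 2)) * cis (atan l).
Proof.
have p0 : 0 < 1 + l ^+ 2 by rewrite ltr_pwDl // sqr_ge0.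
have s0 : Num.sqrt (1 + l ^+ 2) != 0 by rewrite gt_eqF // sqrtr_gt0.
have ca := cos_atan l.
have sa : sin (atan l) = l / Num.sqrt (1 + l ^+ 2).
  have := atanK l; rewrite /tan ca invrK => h.
  by rewrite -[X in X / _]h mulfK.
by apply: complex_ext; rewrite ?cReD ?cReM ?cImD ?cImM /= ?ca ?sa; field.
Qed.

Lemma char_poly_creal n (A : 'M[R]_n) lam : is_eigenvalues A lam ->
  char_poly (map_mx (@creal R) A) = \prod_(i < n) ('X - (creal (lam i))%:P).
Proof.
move=> eA; have := congr1 (map_poly (@real_complex_def R (Phant R))) eA.
rewrite (map_char_poly (real_complex R)) => ->.
rewrite rmorph_prod; apply: eq_bigr => i _.
by rewrite rmorphB /= map_polyX map_polyC.
Qed.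

Lemma slag_V_eigen n (A : 'M[R]_n) lam : is_eigenvalues A lam ->
  slag_V A = \prod_i Num.sqrt (1 + lam i ^+ 2).
Proof.
move=> eA; rewrite /slag_V.
have eA' := char_poly_creal eA.
have -> : \det (1%:M + A *m A) = \prod_i (1 + lam i ^+ 2).
  suff /(congr1 (@complex.Re R)) : creal (\det (1%:M + A *m A)) = creal (\prod_i (1 + lam i ^+ 2)) by [].
  rewrite /creal -det_map_mx.
  have -> : map_mx (real_complex R) (1%:M + A *m A) =
     (1%:M + imagC *: map_mx (@creal R) A) *m (1%:M + (- imagC) *: map_mx (@creal R) A).
    rewrite mulmxDr !mulmxDl !mul1mx mulmx1 -scalemxAl -scalemxAr scalerA.
    have -> : imagC * - imagC = 1 :> C by apply: complex_ext; rewrite ?cReM ?cImM /=; ring.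
    by rewrite scale1r map_mxD map_mx1 map_mxM scaleNr addrA addrK.
  rewrite det_mulmx !(det_1pZ_eigen _ eA') -big_split /= rmorph_prod.
  apply: eq_bigr => i _; apply: complex_ext; rewrite ?cReM ?cImM ?cReD ?cImD ?cReM ?cImM /=; ring.
elim/big_rec2: _ => [|i x y _ <-]; first by rewrite sqrtr1.
by rewrite sqrtrM // addr_ge0 // sqr_ge0.
Qed.

(** Each factor 1 + i lam of det(1 + i A) has modulus sqrt(1 + lam^2) and
    argument atan lam. So the special Lagrangian equation says that the
    argument of det(1 + i D^2u) is constant and its modulus is V: a polynomial
    condition on the Hessian, insensitive to the lack of smoothness of
    eigenvalues. *)
Lemma slag_phase n (A : 'M[R]_n) lam : is_eigenvalues A lam ->
  \det (1%:M + imagC *: map_mx (@creal R) A) =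
  creal (slag_V A) * cis (\sum_i atan (lam i)).
Proof.
move=> eA; rewrite (slag_V_eigen eA).
have eA' := char_poly_creal eA.
rewrite (det_1pZ_eigen _ eA').
elim/big_rec3: _ => [|i t p q _ ->].
  by rewrite creal1 mul1r /cis cos0 sin0.
by rewrite one_pi_cis crealM cisD mulrACA.
Qed.

Lemma phase_det_conj n (Q A : 'M[R]_n) : Q *m Q^T = 1%:M ->
  \det (1%:M + imagC *: map_mx (@creal R) (Q *m A *m Q^T)) =
  \det (1%:M + imagC *: map_mx (@creal R) A).
Proof.
move=> Q1; pose P := map_mx (real_complex R) Q.
have P1 : P *m P^T = 1%:M by rewrite /P map_trmx -map_mxM Q1 map_mx1.
have -> : 1%:M + imagC *: map_mx (@creal R) (Q *m A *m Q^T) =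
   P *m (1%:M + imagC *: map_mx (@creal R) A) *m P^T.
  rewrite mulmxDr mulmx1 mulmxDl P1 -scalemxAr -scalemxAl; congr (_ + _ *: _).
  by rewrite -[LHS]/(map_mx (real_complex R) _) !map_mxM /P map_trmx.
by rewrite !det_mulmx mulrAC -det_mulmx P1 det1 mul1r.
Qed.

(** The conclusions are stated for eigenvalues in an eigenvector frame, where
    both V and the Frobenius norm are explicit. *)
Lemma slag_V_spectral n (Q A : 'M[R]_n) d : Q *m Q^T = 1%:M ->
  Q *m A *m Q^T = diag_mx d ->
  slag_V A ^+ 2 = \prod_i (1 + d ord0 i ^+ 2) /\
  (A^T = A -> mxnorm A ^+ 2 = \sum_i d ord0 i ^+ 2).
Proof.
move=> Q1 Qd; have Q1' := mulmx1C Q1.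
have AE : A = Q^T *m diag_mx d *m Q.
  by rewrite -Qd !mulmxA Q1' mul1mx -mulmxA Q1' mulmx1.
have A2 : A *m A = Q^T *m diag_mx (\row_i d ord0 i ^+ 2) *m Q.
  have -> : diag_mx (\row_i d ord0 i ^+ 2) = diag_mx d *m diag_mx d.
    rewrite mulmx_diag; congr diag_mx; apply/rowP => i; by rewrite !mxE expr2.
  rewrite {1 2}AE !mulmxA -[Q^T *m diag_mx d *m Q *m Q^T]mulmxA Q1 mulmx1.
  by rewrite -!mulmxA.
split.
  have -> : slag_V A ^+ 2 = \det (1%:M + A *m A).
    rewrite sqr_sqrtr //.
    have -> : 1%:M + A *m A = Q^T *m (1%:M + diag_mx (\row_i d ord0 i ^+ 2)) *m Q.
      by rewrite mulmxDr mulmx1 mulmxDl Q1' A2.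
    rewrite !det_mulmx mulrAC -det_mulmx Q1' det1 mul1r.
    rewrite -diag_const_mx -raddfD det_diag /=; apply: prodr_ge0 => i _.
    by rewrite !mxE addr_ge0 // sqr_ge0.
  have -> : 1%:M + A *m A = Q^T *m (1%:M + diag_mx (\row_i d ord0 i ^+ 2)) *m Q.
    by rewrite mulmxDr mulmx1 mulmxDl Q1' A2.
  rewrite !det_mulmx mulrAC -det_mulmx Q1' det1 mul1r.
  by rewrite -diag_const_mx -raddfD det_diag /=; apply: eq_bigr => i _; rewrite !mxE.
move=> AT; have AS a b : A a b = A b a by rewrite -{1}AT mxE.
rewrite sqr_sqrtr; last by do 2!apply: sumr_ge0 => ? _; exact: sqr_ge0.
have -> : \sum_i \sum_j A i j ^+ 2 = \tr (A *m A).
  apply: eq_bigr => i _; rewrite mxE; apply: eq_bigr => j _.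
  by rewrite expr2 {2}(AS i j).
rewrite A2 mxtrace_mulC mulmxA Q1 mul1mx mxtrace_diag.
by apply: eq_bigr => i _; rewrite mxE.
Qed.

Lemma slag_V_bounds n (A : 'M[R]_n) lam : A^T = A -> is_eigenvalues A lam ->
  [/\ 1 <= slag_V A, mxnorm A <= slag_V A & slag_V A <= (1 + mxnorm A ^+ 2) ^+ n].
Proof.
move=> AT eA; have [Q Q1 [d Qd]] := spectral_symmetric AT eA.
have [V2 /(_ AT) M2] := slag_V_spectral Q1 Qd.
have V0 : 0 <= slag_V A by exact: sqrtr_ge0.
have sq0 i : 0 <= d ord0 i ^+ 2 by exact: sqr_ge0.
have P1 : 1 + \sum_i d ord0 i ^+ 2 <= \prod_i (1 + d ord0 i ^+ 2).
  have [] // : 0 <= \sum_i d ord0 i ^+ 2 /\ 1 + \sum_i d ord0 i ^+ 2 <= \prod_i (1 + d ord0 i ^+ 2).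
  elim/big_rec2: _ => [|i s p _ [s0 h]]; first by rewrite addr0.
  split; first by rewrite addr_ge0.
  have := sq0 i; move: (d ord0 i ^+ 2) => x x0.
  have : (1 + x) * (1 + s) <= (1 + x) * p by apply: ler_wpM2l => //; lra.
  apply: le_trans; rewrite mulrDl !mulrDr !mul1r !mulr1.
  have : 0 <= x * s by rewrite mulr_ge0.
  lra.
have S0 : 0 <= \sum_i d ord0 i ^+ 2 by apply: sumr_ge0.
have V1 : 1 <= slag_V A.
  rewrite -(@ler_pXn2r _ 2) ?nnegrE // V2 expr1n; lra.
split => //.
  rewrite -(@ler_pXn2r _ 2) ?nnegrE ?mxnorm_ge0 // V2 M2; lra.
apply: (@le_trans _ _ (slag_V A ^+ 2)); first by rewrite expr2 ler_peMl.
rewrite V2 M2 -[n in _ ^+ n]card_ord -prodr_const; apply: ler_prod => i _.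
rewrite addr_ge0 //= lerD2l (bigD1 i) //= lerDl; exact: sumr_ge0.
Qed.

End DetEig.

(** * The maximum principle *)

Section Tensors.
Variables (R : realType) (n : nat) (U : set 'rV[R]_n) (u : 'rV[R]_n -> R).
Hypothesis oU : open U.
Hypothesis su : smooth_on U u.
Implicit Types (v w : 'rV[R]_n).

Lemma hessian_sym x : U x -> (hessian u x)^T = hessian u x.
Proof.
by move=> Ux; apply/matrixP => i j; rewrite !mxE; exact: (schwarz oU _ _ su Ux).
Qed.

Lemma second_derive_hessian v w x : U x ->
  'D_v ('D_w u) x = \sum_i \sum_j v ord0 i * hessian u x i j * w ord0 j.
Proof.
move=> Ux.
have -> : 'D_v ('D_w u) x = 'D_v (fun y => \sum_j w ord0 j * pderiv j u y) x.
  by apply: (derive_eq_on oU v Ux) => y Uy; rewrite (derive_smooth oU _ su Uy).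
have H : is_derive x v (fun y => \sum_j w ord0 j * pderiv j u y)
    (\sum_j w ord0 j * (\sum_i v ord0 i * pderiv i (pderiv j u) x)).
  apply: (@is_derive_lincomb _ _ _ (fun j => w ord0 j) (fun j => pderiv j u)) => j.
  by apply: (is_derive_smooth oU) => //; exact: smooth_on_pderiv.
rewrite (@derive_val _ _ _ _ _ _ _ H) exchange_big /=; apply: eq_bigr => j _.
by rewrite big_distrr /=; apply: eq_bigr => i _; rewrite mxE; ring.
Qed.

(** Two transpositions generating all the permutations of the indices. *)
Lemma third_derivative_sym a b k x : U x ->
  'D_k ('D_a ('D_b u)) x = 'D_k ('D_b ('D_a u)) x /\
  'D_k ('D_a ('D_b u)) x = 'D_b ('D_a ('D_k u)) x.
Proof.
move=> Ux.
have s1 (p q r : 'rV[R]_n) : 'D_p ('D_q ('D_r u)) x = 'D_p ('D_r ('D_q u)) x.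
  by apply: (derive_eq_on oU p Ux) => y Uy; exact: (schwarz oU q r su Uy).
have s2 (p q r : 'rV[R]_n) : 'D_p ('D_q ('D_r u)) x = 'D_q ('D_p ('D_r u)) x.
  exact: (schwarz oU p q (smooth_on_derive oU r su) Ux).
split; first exact: s1.
exact: (etrans (s1 k a b) (etrans (s2 k b a) (s1 b k a))).
Qed.

Lemma fourth_derivative_sym a k x : U x ->
  'D_k ('D_k ('D_a ('D_a u))) x = 'D_a ('D_a ('D_k ('D_k u))) x.
Proof.
move=> Ux.
have sD p : smooth_on U ('D_p u) by exact: smooth_on_derive.
have sDD p q : smooth_on U ('D_p ('D_q u)) by exact: smooth_on_derive.
have t1 (p q r s : 'rV[R]_n) : 'D_p ('D_q ('D_r ('D_s u))) x =
    'D_p ('D_r ('D_q ('D_s u))) x.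
  by apply: (derive_eq_on oU p Ux) => y Uy; exact: (schwarz oU q r (sD s) Uy).
have t0 (p q r s : 'rV[R]_n) : 'D_p ('D_q ('D_r ('D_s u))) x =
    'D_q ('D_p ('D_r ('D_s u))) x by exact: (schwarz oU p q (sDD r s) Ux).
have t2 (p q r s : 'rV[R]_n) : 'D_p ('D_q ('D_r ('D_s u))) x =
    'D_p ('D_q ('D_s ('D_r u))) x.
  apply: (derive_eq_on oU p Ux) => y Uy; apply: (derive_eq_on oU q Uy) => z Uz.
  exact: (schwarz oU r s su Uz).
exact: (etrans (t1 k k a a) (etrans (t0 k a k a) (etrans (t2 a k k a) (t1 a k a k)))).
Qed.

End Tensors.

Lemma orthogonal_sum_sqr (R : realType) n (Q : 'M[R]_n) (z : 'I_n -> R) : Q *m Q^T = 1%:M ->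
  \sum_a (\sum_i Q a i * z i) ^+ 2 = \sum_i z i ^+ 2.
Proof.
move=> Q1; pose v : 'rV[R]_n := \row_i z i.
have e1 (w : 'rV[R]_n) : (w *m w^T) 0 0 = \sum_i w 0 i ^+ 2.
  by rewrite mxE; apply: eq_bigr => i _; rewrite mxE expr2.
transitivity (((v *m Q^T) *m (v *m Q^T)^T) 0 0).
  rewrite e1; apply: eq_bigr => a _; congr (_ ^+ 2); rewrite mxE.
  by apply: eq_bigr => i _; rewrite !mxE mulrC.
rewrite trmx_mul trmxK mulmxA -[v *m _ *m Q]mulmxA (mulmx1C Q1) mulmx1 e1.
by apply: eq_bigr => i _; rewrite mxE.
Qed.

Lemma sum_mul_exchange (R : comNzRingType) (I : finType) (g z : I -> R) (T : I -> I -> R) :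
  \sum_k g k * (\sum_a z a * T k a) = \sum_a z a * \sum_k g k * T k a.
Proof.
under eq_bigr do rewrite big_distrr /=.
rewrite exchange_big /=; apply: eq_bigr => a _; rewrite big_distrr /=.
by apply: eq_bigr => k _; rewrite mulrCA.
Qed.

(** The vector K (x - y) + (Du(x) - Du(y)) is, up to scaling, the displacement in
    the coordinates of a rotated gradient graph. Both x and Du are harmonic for
    the induced metric, so its squared length behaves like a squared distance
    on a minimal submanifold. *)
Definition twist (R : realType) n (K : R) (u : 'rV[R]_n -> R) (y x : 'rV[R]_n) (i : 'I_n) : R :=
  K * (x ord0 i - y ord0 i) + (pderiv i u x - pderiv i u y).

Definition twist_sqr (R : realType) n (K : R) (u : 'rV[R]_n -> R) (y x : 'rV[R]_n) : R :=
  \sum_i twist K u y x i ^+ 2.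

Definition barrier (R : realType) n (K kap m : R) (u : 'rV[R]_n -> R) (y x : 'rV[R]_n) : R :=
  expR (- (kap * twist_sqr K u y x)) - expR (- (kap * m)).

Section InteriorMax.
Variables (R : realType) (n : nat) (U : set 'rV[R]_n.+1) (Theta : R).
Variables (u : 'rV[R]_n.+1 -> R) (K kap m : R) (y x0 : 'rV[R]_n.+1) (M : nat).
Hypothesis oU : open U.
Hypothesis su : smooth_on U u.
Hypothesis u2 : forall x v, U x -> 0 <= 'D_v ('D_v u) x.
Hypothesis sl : special_lagrangian U Theta u.
Hypothesis Ux0 : U x0.
Hypothesis Uy : U y.
Hypothesis K1 : 1 <= K.
Hypothesis kap0 : 0 < kap.
Let V x := slag_V (hessian u x).
Let h := barrier K kap m u y.

(** Along each vector of an orthonormal eigenbasis of the Hessian at x0, V and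
    the barrier have explicit second-order expansions. A local maximum of
    V h^M gives one inequality per direction; their sum weighted by g
    contradicts the strict positivity of the operator applied to the barrier. *)
Lemma no_interior_max : (n.+1 <= M)%N -> 0 < h x0 ->
  n.+1%:R * (K ^+ 2 + 1) < 2 * kap * twist_sqr K u y x0 ->
  ~ (\forall x \near x0, V x * h x ^+ M <= V x0 * h x0 ^+ M).
Proof.
move=> nM h00 hk hmax.
have [lam [eA _]] := sl Ux0.
have [Q Q1 [d Qd]] := spectral_symmetric (hessian_sym oU su Ux0) eA.
pose q a : 'rV[R]_n.+1 := row a Q.
pose H x : 'M[R]_n.+1 := \matrix_(a, b) 'D_(q a) ('D_(q b) u) x.
have HE x : U x -> H x = Q *m hessian u x *m Q^T.
  move=> Ux; apply/matrixP => a b; rewrite mxE (second_derive_hessian oU) // exchange_big /= mxE.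
  apply: eq_bigr => j _; rewrite [in RHS]mxE big_distrl /=; apply: eq_bigr => i _.
  by rewrite /q !mxE.
pose l a := d ord0 a.
have H0 a b : H x0 a b = l a *+ (a == b).
  by rewrite HE // Qd mxE.
have l0 a : 0 <= l a.
  by have := u2 (q a) Ux0; have := H0 a a; rewrite mxE eqxx mulr1n => ->.
pose g a := (1 + l a ^+ 2)^-1.
have g0 a : 0 <= g a by rewrite invr_ge0 addr_ge0 // sqr_ge0.
pose T3 a b k := 'D_(q k) ('D_(q a) ('D_(q b) u)) x0.
pose B4 k a b := 'D_(q k) ('D_(q k) ('D_(q a) ('D_(q b) u))) x0 / 2.
have T12 a b k : T3 a b k = T3 b a k.
  by have [e _] := third_derivative_sym oU su (q a) (q b) (q k) Ux0; exact: e.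
have T13 a b k : T3 a b k = T3 a k b.
  have [_ e] := third_derivative_sym oU su (q a) (q b) (q k) Ux0.
  exact: e.
have BS k a : B4 k a a = B4 a k k.
  exact: (congr1 (fun t => t / 2) (fourth_derivative_sym oU su (q a) (q k) Ux0)).
have sDD a b : smooth_on U ('D_(q a) ('D_(q b) u)).
  by exact: (smooth_on_derive oU _ (smooth_on_derive oU _ su)).
have lineU k : \forall t \near (0 : R), U (x0 + t *: q k).
  by apply: near_line; exact: open_nbhs_nbhs.
have VE x : U x -> \det (1%:M + imagC *: map_mx (@creal R) (H x)) = creal (V x) * cis Theta.
  move=> Ux; rewrite HE // phase_det_conj //.
  by have [mu [eM <-]] := sl Ux; exact: slag_phase.
have V0 : 0 < V x0.
  apply: lt_le_trans ltr01 _.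
  by have [] := slag_V_bounds (hessian_sym oU su Ux0) eA.
have at0 k : x0 + 0 *: q k = x0 by rewrite scale0r addr0.
pose tau k := \sum_a g a * l a * T3 a a k.
pose nu k := tau k ^+ 2 / 2
   - (\sum_a \sum_b (l a * l b - 1) * g a * g b * T3 a b k ^+ 2) / 2
   + \sum_a g a * l a * B4 k a a.
have jets k : [/\ \sum_a g a * T3 a a k = 0,
   \sum_a g a * B4 k a a = (\sum_a \sum_b (l a + l b) * g a * g b * T3 a b k ^+ 2) / 2 &
   jet (fun t => V (x0 + t *: q k)) (V x0) (V x0 * tau k) (V x0 * nu k)].
  have := @phase_jets R n (fun t => H (x0 + t *: q k)) l (\matrix_(a, b) T3 a b k)
    (\matrix_(a, b) B4 k a b) (fun t => V (x0 + t *: q k)) (cis Theta) (cis_neq0 _).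
  rewrite at0 (gt_eqF V0) => /(_ isT) [].
  - by apply: filterS (lineU k) => t; exact: VE.
  - move=> a b; have j := jet_smooth_line oU (q k) (sDD a b) Ux0.
    have e : 'D_(q a) ('D_(q b) u) x0 = l a *+ (a == b) by rewrite -H0 mxE.
    have e1 : T3 a b k = (\matrix_(a, b) T3 a b k) a b by rewrite mxE.
    have e2 : B4 k a b = (\matrix_(a, b) B4 k a b) a b by rewrite mxE.
    apply: jet_ext (jet_eq j e e1 e2).
    by near=> t; rewrite [RHS]mxE.
  have sqE a b : (\matrix_(a, b) T3 a b k) a b * (\matrix_(a, b) T3 a b k) b a = T3 a b k ^+ 2.
    by rewrite !mxE (T12 b a) expr2.
  move=> e1 e2 e3; split.
  - by rewrite -[RHS]e1; apply: eq_bigr => a _; rewrite mxE.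
  - transitivity (\sum_i (1 + l i ^+ 2)^-1 * (\matrix_(a, b) B4 k a b) i i).
      by apply: eq_bigr => a _; rewrite mxE.
    rewrite e2; congr (_ / 2); apply: eq_bigr => a _; apply: eq_bigr => b _.
    by rewrite sqE.
  have tE : \sum_i (1 + l i ^+ 2)^-1 * l i * (\matrix_(a, b) T3 a b k) i i = tau k.
    by apply: eq_bigr => a _; rewrite mxE.
  have nuE S S' : S = \sum_a \sum_b (l a * l b - 1) * g a * g b * T3 a b k ^+ 2 ->
      S' = \sum_a g a * l a * B4 k a a -> tau k ^+ 2 / 2 - S / 2 + S' = nu k.
    by move=> -> ->.
  move: e3; rewrite tE nuE; [exact: id | |].
    by apply: eq_bigr => a _; apply: eq_bigr => b _; rewrite sqE.
  by apply: eq_bigr => a _; rewrite mxE.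
(* Components of the twisted displacement in the eigenvector frame. *)
pose z a (x : 'rV[R]_n.+1) :=
  K * (\sum_i Q a i * (x ord0 i - y ord0 i)) + ('D_(q a) u x - 'D_(q a) u y).
have zE (x : 'rV[R]_n.+1) : U x -> twist_sqr K u y x = \sum_a z a x ^+ 2.
  move=> Ux; rewrite /twist_sqr -(orthogonal_sum_sqr _ Q1); apply: eq_bigr => a _.
  apply: (congr1 (fun t => t ^+ 2)); rewrite /z.
  rewrite (derive_smooth oU (q a) su Ux) (derive_smooth oU (q a) su Uy).
  rewrite -sumrB big_distrr -big_split /=.
  apply: eq_bigr => i _; rewrite /twist [q a ord0 i]mxE.
  by move: (pderiv i u x) (pderiv i u y) => p p'; ring.
have QQ a k : \sum_i Q a i * q k ord0 i = (a == k)%:R.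
  have /matrixP/(_ a k) := Q1; rewrite !mxE => <-.
  by apply: eq_bigr => i _; rewrite !mxE.
pose b k a : R := if a == k then K + l k else 0.
have jz k a : jet (fun t => z a (x0 + t *: q k)) (z a x0) (b k a) (T3 k a k / 2).
  have j1 := jet_smooth_line oU (q k) (smooth_on_derive oU (q a) su) Ux0.
  have j2 := jet_poly (K * (\sum_i Q a i * (x0 ord0 i - y ord0 i))) (K * (a == k)%:R) 0.
  have := jetD j2 (jetB j1 (jet_cst ('D_(q a) u y))).
  have e1 : 'D_(q k) ('D_(q a) u) x0 = l k *+ (k == a) by rewrite -H0 mxE.
  rewrite e1 !subr0 add0r.
  have -> : K * (a == k)%:R + l k *+ (k == a) = b k a.
    by rewrite /b eq_sym; case: (k == a); rewrite ?mulr1 // mulr0 mulr0n addr0.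
  apply: jet_ext; near=> t.
  rewrite /z; apply: (congr1 (fun r => r + _)); rewrite mul0r addr0 -mulrA -mulrDr.
  apply: (congr1 (fun r => K * r)); rewrite -QQ big_distrl -big_split /=.
  by apply: eq_bigr => i _; rewrite !mxE; ring.
pose s1 k := 2 * ((K + l k) * z k x0).
pose qq k := \sum_a z a x0 * T3 k a k.
pose s2 k := (K + l k) ^+ 2 + qq k.
have js k : jet (fun t => twist_sqr K u y (x0 + t *: q k)) (twist_sqr K u y x0) (s1 k) (s2 k).
  have := jet_sum (index_enum 'I_n.+1) (fun a => jetM (jz k a) (jz k a)).
  have -> : \sum_(a <- index_enum 'I_n.+1) z a x0 * z a x0 = twist_sqr K u y x0.
    by rewrite zE //; apply: eq_bigr => a _; rewrite expr2.
  have -> : \sum_(a <- index_enum 'I_n.+1) (z a x0 * b k a + b k a * z a x0) = s1 k.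
    rewrite (bigD1 k) //= big1 => [|a /negPf ak]; last by rewrite /b ak mulr0 mul0r addr0.
    by rewrite /b eqxx /s1; ring.
  have -> : \sum_(a <- index_enum 'I_n.+1) (z a x0 * (T3 k a k / 2) + b k a * b k a +
     T3 k a k / 2 * z a x0) = s2 k.
    rewrite /s2 /qq; transitivity (\sum_a b k a * b k a + \sum_a z a x0 * T3 k a k).
      rewrite -big_split /=; apply: eq_bigr => a _.
      by move: (T3 k a k) (z a x0) (b k a) => ? ? ?; field.
    rewrite (bigD1 k) //= big1 => [|a /negPf ak]; last by rewrite /b ak mulr0.
    by rewrite /b eqxx addr0 expr2.
  apply: jet_ext; near=> t; rewrite zE; last by near: t; exact: lineU.
  by apply: eq_bigr => a _; rewrite expr2.
pose e0 := expR (- (kap * twist_sqr K u y x0)).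
pose eta k := (h x0)^-1 * (e0 * - (kap * s1 k)).
pose zeta k := (h x0)^-1 * (e0 * (- (kap * s2 k) + (- (kap * s1 k)) ^+ 2 / 2)).
have h0n : h x0 != 0 by rewrite gt_eqF.
have jh k : jet (fun t => (h x0)^-1 * h (x0 + t *: q k)) 1 (eta k) (zeta k).
  have j1 := jetN (jetM (jet_cst kap) (js k)).
  have j2 := jetB (jet_expR j1) (jet_cst (expR (- (kap * m)))).
  have j3 := jetM (jet_cst (h x0)^-1) j2.
  apply: (jet_eq (f := fun t => (h x0)^-1 * h (x0 + t *: q k)) j3).
  - by rewrite -[X in _ * X]/(h x0) mulVf.
  - by rewrite /eta -/e0; move: (e0) (h x0) (s1 k) (twist_sqr _ _ _ _) => ? ? ? ?; ring.
  - by rewrite /zeta -/e0; move: (e0) (h x0) (s1 k) (s2 k) (twist_sqr _ _ _ _) => ? ? ? ? ?; ring.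
have key k : tau k + M%:R * eta k = 0 /\
   nu k + M%:R * (tau k * eta k) + (M%:R * zeta k + M%:R * (M%:R - 1) / 2 * eta k ^+ 2) <= 0.
  have [_ _ jV] := jets k.
  have jV' := jetM (jet_cst (V x0)^-1) jV.
  have Vn0 : V x0 != 0 by rewrite gt_eqF.
  have j3 : jet (fun t => (V x0)^-1 * V (x0 + t *: q k)) 1 (tau k) (nu k).
    apply: (jet_eq jV'); first by rewrite mulVf.
    - by rewrite mul0r addr0 mulKf.
    - by rewrite !mul0r !addr0 mulKf.
  have [|e1 e2] := jet_max (jet_eq (jetM j3 (jetX M (jh k))) (mulr1 1) erefl erefl).
    near=> t.
    have : V (x0 + t *: q k) * h (x0 + t *: q k) ^+ M <= V x0 * h x0 ^+ M.
      near: t.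
      exact: (@near_line _ _ (fun x => V x * h x ^+ M <= V x0 * h x0 ^+ M) _ (q k) hmax).
    have hM : 0 < h x0 ^+ M by rewrite exprn_gt0.
    move: (V (x0 + t *: q k)) (h (x0 + t *: q k)) => v w vw.
    rewrite exprMn mulrACA exprVn -invfM [leLHS]mulrC ler_pdivrMr ?mul1r //.
    by rewrite mulr_gt0.
  split; first by rewrite addrC -[tau k]mulr1 -[X in X + _ = _]mul1r.
  move: e2; move: (nu k) (tau k) (eta k) (zeta k) => ? ? ? ?.
  by apply: le_trans; rewrite le_eqVlt; apply/orP; left; apply/eqP; ring.
have n0 : 0 < n.+1%:R :> R by rewrite ltr0n.
have nM' : n.+1%:R <= M%:R :> R by rewrite ler_nat.
have tauE k : tau k = \sum_a g a * l a * T3 a a k by [].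
have hB k : \sum_a g a * B4 k a a =
   (\sum_a \sum_b (l a + l b) * g a * g b * T3 a b k ^+ 2) / 2 by have [] := jets k.
have J := @jacobi_inequality R n.+1 l g T3 (fun k a => B4 k a a) tau nu l0 g0 T12 T13
  BS hB tauE (fun k => erefl _).
have := weighted_max_inequality n0 nM' g0 (fun k => (key k).1) (fun k => (key k).2) J.
apply/negP; rewrite -ltNge.
(* The third derivatives of u drop out: each component of Du is harmonic. *)
have gq : \sum_k g k * qq k = 0.
  rewrite (sum_mul_exchange g (fun a => z a x0) (fun k a => T3 k a k)).
  apply: big1 => a _.
  have -> : \sum_k g k * T3 k a k = 0; last by rewrite mulr0.
  have [e _ _] := jets a; rewrite -[RHS]e.
  by apply: eq_bigr => k _; rewrite (T13 k k a).
have hz k : h x0 * zeta k = e0 * (- kap * s2 k + (- kap * s1 k) ^+ 2 / 2).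
  by rewrite /zeta mulVKf // !mulNr.
apply: (@barrier_subsolution R n.+1 g l (fun k => z k x0) qq s1 s2 zeta K kap e0 (h x0)
  (fun k => erefl _) l0 K1 kap0 (expR_gt0 _) h00 (fun k => erefl _) (fun k => erefl _) gq hz).
by rewrite -zE.
Unshelve. all: by end_near. Qed.

End InteriorMax.

(** * The doubling inequality *)

Section Constants.
Variables (R : realType) (n : nat).

(** Bounds the twisted squared distance on the ball of radius the inverse of
    twist_slope, since every component is at most 1 + 2 N there. *)
Definition twist_bound (N : R) : R := n%:R * (1 + 2 * N) ^+ 2.
(** Chosen so that the twisted squared distance is at least
    (1 + twist_bound)^2 on the sphere of radius 1/4, strictly more than
    twist_bound. *)
Definition twist_slope (N : R) : R := 4 * (1 + twist_bound N).
(** Twice the value beyond which barrier_subsolution applies outside the ball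
    of radius r. *)
Definition barrier_rate (r N : R) : R :=
  n%:R * (twist_slope N ^+ 2 + 1) / (twist_slope N ^+ 2 * r ^+ 2).
Definition barrier_gap (r N : R) : R :=
  expR (- (barrier_rate r N * twist_bound N)) -
  expR (- (barrier_rate r N * (1 + twist_bound N) ^+ 2)).
(** At least n for the maximum argument, and odd so that the power keeps the
    sign of the barrier. *)
Definition doubling_exponent : nat := n.*2.+1.
Definition doubling_const (r N : R) : R := barrier_gap r N ^- doubling_exponent.

End Constants.

Section Doubling.
Variables (R : realType) (n : nat) (Theta N : R) (u : 'rV[R]_n.+1 -> R).
Let U : set 'rV[R]_n.+1 := eball 0 2.
Hypothesis su : smooth_on U u.
Hypothesis cu : convex_function U u.
Hypothesis sl : special_lagrangian U Theta u.
Hypothesis N0 : 0 <= N.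
Hypothesis gradN : forall x i, eball 0 1 x -> `|pderiv i u x| <= N.
Variable y : 'rV[R]_n.+1.
Hypothesis yB : eball 0 (1 / 2) y.

Let oU : open U. Proof. exact: eball_open. Qed.
Let V x := slag_V (hessian u x).
Let K := twist_slope n.+1 N.
Let L := twist_bound n.+1 N.

Let L0 : 0 <= L. Proof. by rewrite mulr_ge0 // sqr_ge0. Qed.
Let KE : K = 4 * (1 + L). Proof. by []. Qed.
Let K4 : 4 <= K. Proof. by rewrite KE; have := L0; lra. Qed.

Let Kp : 0 < K. Proof. by have := K4; lra. Qed.
Let K1 : 1 <= K. Proof. by have := K4; lra. Qed.

Let B1 : cball y (4^-1) `<=` eball 0 1.
Proof.
move=> x; rewrite /cball /eball /= subr0 => xy.
have := enormD (x - y) y; rewrite subrK; move: yB; rewrite /eball /= subr0; lra.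
Qed.

Let B1U : eball 0 1 `<=` U.
Proof. by move=> x; rewrite /U /eball /=; lra. Qed.

Let cU : cball y (4^-1) `<=` U.
Proof. by move=> x /B1/B1U. Qed.

Let Uy : U y.
Proof. by move: yB; rewrite /U /eball /=; lra. Qed.

Let y1 : eball 0 1 y.
Proof. by move: yB; rewrite /eball /=; lra. Qed.

(** The cross term is nonnegative because the gradient of a convex function is
    monotone. *)
Lemma twist_lower x : U x -> (K * enorm (x - y)) ^+ 2 <= twist_sqr K u y x.
Proof.
move=> Ux; rewrite exprMn enorm_sqr /twist_sqr.
have mono := convex_monotone su cu Ux Uy.
rewrite !(derive_smooth oU) // in mono.
have -> : \sum_i twist K u y x i ^+ 2 = K ^+ 2 * (\sum_i (x - y) ord0 i ^+ 2) +
   2 * K * (\sum_i (x - y) ord0 i * pderiv i u x - \sum_i (x - y) ord0 i * pderiv i u y) +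
   \sum_i (pderiv i u x - pderiv i u y) ^+ 2.
  rewrite -sumrB !big_distrr -!big_split /=; apply: eq_bigr => i _.
  rewrite /twist !mxE; move: (pderiv i u x) (pderiv i u y) => ? ?; ring.
rewrite -addrA lerDl addr_ge0 //; last by apply: sumr_ge0 => i _; exact: sqr_ge0.
by rewrite mulr_ge0 ?subr_ge0 // mulr_ge0 // ltW.
Qed.

Lemma twist_upper x : eball 0 1 x -> K * enorm (x - y) <= 1 -> twist_sqr K u y x <= L.
Proof.
move=> xB xy.
have -> : L = \sum_(i < n.+1) (1 + 2 * N) ^+ 2.
  by rewrite sumr_const card_ord -[RHS]mulr_natl.
apply: ler_sum => i _.
have K0 := ltW Kp.
have h : `|twist K u y x i| <= 1 + 2 * N.
  apply: (le_trans (ler_normD _ _)); apply: lerD.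
    rewrite normrM ger0_norm //; apply: le_trans xy; rewrite ler_wpM2l //.
    by have := coord_le_enorm (x - y) i; rewrite !mxE.
  apply: (le_trans (ler_normB _ _)).
  by have := gradN i xB; have := gradN i y1; lra.
rewrite -real_normK ?num_real // ler_pXn2r ?nnegrE ?addr_ge0 ?mulr_ge0 //.
Qed.

Lemma twist_self : twist_sqr K u y y = 0.
Proof. by apply: big1 => i _; rewrite /twist !subrr mulr0 addr0 expr0n. Qed.

Lemma barrier_continuous kap m x : U x -> {for x, continuous (barrier K kap m u y)}.
Proof.
move=> Ux; apply: continuousB; last exact: cst_continuous.
apply: continuous_at_comp; last exact: continuous_expR.
apply: continuousN; apply: continuousM; first exact: cst_continuous.
apply: continuous_at_sum => i; apply: continuous_at_exp; apply: continuousD.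
  apply: continuousM; first exact: cst_continuous.
  apply: continuousB; last exact: cst_continuous.
  exact: coord_continuous.
apply: continuousB; last exact: cst_continuous.
exact: (smooth_continuous (smooth_on_pderiv i su) Ux).
Qed.

Lemma slag_V_ge1 x : U x -> 1 <= V x.
Proof.
move=> Ux; have [lam [eA _]] := sl Ux.
by have [] := slag_V_bounds (hessian_sym oU su Ux) eA.
Qed.

(** The function V h^M is maximised over the closed ball of radius 1/4. Its
    maximum is positive since h(y) > 0, whereas h <= 0 on the boundary sphere,
    so it is attained inside; by the maximum principle it is attained within
    distance r of y. On the ball of radius 1/K the barrier is bounded below by
    its gap. *)
Lemma slag_V_doubling r : 0 < r -> r <= K^-1 ->
  let c := doubling_const n.+1 r N in
  1 <= c /\ exists2 x1, eball y r x1 & forall x, eball y K^-1 x -> V x <= c * V x1.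
Proof.
move=> r0 rK; set M := doubling_exponent n.+1.
set kap := barrier_rate n.+1 r N; set g := barrier_gap n.+1 r N.
have n0 : 0 < n.+1%:R :> R by rewrite ltr0n.
have Kr : 0 < K ^+ 2 * r ^+ 2 by rewrite mulr_gt0 // exprn_gt0.
have K21 : 0 < n.+1%:R * (K ^+ 2 + 1) by rewrite mulr_gt0 // ltr_wpDl // sqr_ge0.
have kap0 : 0 < kap by rewrite divr_gt0.
have kapE : kap * (K ^+ 2 * r ^+ 2) = n.+1%:R * (K ^+ 2 + 1).
  by rewrite /kap /barrier_rate -/K divfK // gt_eqF.
pose m := (1 + L) ^+ 2.
have Lm : L < m.
  rewrite /m sqrrD expr1n mul1r; have := sqr_ge0 L; have := L0; lra.
have g0 : 0 < g by rewrite subr_gt0 ltr_expR ltrN2 ltr_pM2l.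
have g1 : g <= 1.
  have e1 : expR (- (kap * L)) <= 1 by rewrite -expR0 ler_expR oppr_le0 mulr_ge0 ?L0 // ltW.
  by apply: le_trans e1; rewrite gerBl expR_ge0.
have c1 : 1 <= doubling_const n.+1 r N.
  by rewrite /doubling_const invf_ge1 ?exprn_gt0 // exprn_ile1 // ltW.
split=> //.
pose h := barrier K kap m u y.
have Vp x : U x -> 0 < V x by move=> Ux; exact: lt_le_trans ltr01 (slag_V_ge1 Ux).
have c40 : 0 <= 4^-1 :> R by rewrite invr_ge0.
have [x0 x0B x0max] : exists2 x0, cball y 4^-1 x0 &
    forall x, cball y 4^-1 x -> V x * h x ^+ M <= V x0 * h x0 ^+ M.
  apply: cball_max => // x /cU Ux; apply: continuousM.
    exact: slag_V_hessian_continuous su Ux.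
  by apply: continuous_at_exp; exact: barrier_continuous.
have Ux0 : U x0 by exact: cU.
have Modd : odd M by rewrite /M /doubling_exponent /= odd_double.
have hy : 0 < h y.
  rewrite /h /barrier twist_self mulr0 oppr0 subr_gt0 ltr_expR oppr_lt0 mulr_gt0 //.
  by apply: le_lt_trans Lm; exact: L0.
(* The exponent is odd, so a positive product forces a positive barrier. *)
have h0 : 0 < h x0.
  have : 0 < V x0 * h x0 ^+ M.
    apply: lt_le_trans (x0max y _); first by rewrite mulr_gt0 ?exprn_gt0 ?Vp.
    by rewrite /cball /= subrr enorm0.
  by rewrite (pmulr_rgt0 _ (Vp _ Ux0)) (exprn_odd_gt0 _ Modd).
have tw : twist_sqr K u y x0 < m.
  by move: h0; rewrite subr_gt0 ltr_expR ltrN2 ltr_pM2l.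
have x0i : eball y 4^-1 x0.
  have := le_lt_trans (twist_lower Ux0) tw.
  rewrite /m ltr_pXn2r ?nnegrE ?mulr_ge0 ?addr_ge0 ?enorm_ge0 ?(ltW Kp) //.
  have -> : 1 + L = K * 4^-1 by rewrite KE; field.
  by rewrite ltr_pM2l.
exists x0; last first.
  move=> x xB.
  have K14 : K^-1 <= 4^-1 by rewrite lef_pV2 ?posrE // K4.
  have xc : cball y 4^-1 x by rewrite /cball /=; apply: le_trans K14; exact: ltW.
  have hx : g <= h x.
    rewrite lerD2r ler_expR lerN2 ler_pM2l // -/L; apply: twist_upper; first exact: B1.
    by rewrite -(divff (negbT (gt_eqF Kp))) ler_wpM2l ?(ltW Kp) // ltW.
  have h01 : h x0 <= 1.
    have : expR (- (kap * twist_sqr K u y x0)) <= 1.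
      rewrite -expR0 ler_expR oppr_le0 mulr_ge0 ?(ltW kap0) //.
      by apply: sumr_ge0 => i _; exact: sqr_ge0.
    by apply: le_trans; rewrite gerBl expR_ge0.
  have gM : 0 < g ^+ M by rewrite exprn_gt0.
  rewrite /doubling_const mulrC ler_pdivlMr //.
  apply: (@le_trans _ _ (V x * h x ^+ M)).
    apply: ler_wpM2l; first exact: ltW (Vp _ (cU xc)).
    have gn : g \is Num.nneg by rewrite nnegrE ltW.
    have hn : h x \is Num.nneg by rewrite nnegrE (le_trans (ltW g0) hx).
    exact: lerXn2r gn hn hx.
  apply: (le_trans (x0max x xc)); rewrite ler_piMr ?(ltW (Vp _ Ux0)) //.
  exact: (exprn_ile1 _ (ltW h0) h01).
rewrite /eball /= ltNge; apply/negP => rx.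
have nM : (n.+1 <= M)%N.
  by rewrite /M /doubling_exponent -addnn; apply: leq_trans (leqnSn _); exact: leq_addr.
have far : n.+1%:R * (K ^+ 2 + 1) < 2 * kap * twist_sqr K u y x0.
  apply: (@lt_le_trans _ _ (2 * kap * (K ^+ 2 * r ^+ 2))).
    by rewrite -mulrA kapE (ltr_pMl _ K21) ltr1n.
  apply: ler_wpM2l; first by rewrite mulr_ge0 // ltW.
  apply: le_trans (twist_lower Ux0).
  rewrite [leRHS]exprMn; apply: ler_wpM2l; first exact: sqr_ge0.
  have rn : r \is Num.nneg by rewrite nnegrE ltW.
  have dn : enorm (x0 - y) \is Num.nneg by rewrite nnegrE enorm_ge0.
  exact: lerXn2r rn dn rx.
have hmax : \forall x \near x0, V x * h x ^+ M <= V x0 * h x0 ^+ M.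
  have : \forall x \near x0, eball y 4^-1 x.
    by apply: open_nbhs_nbhs; split => //; exact: eball_open.
  by apply: filterS => x /eball_sub_cball xB; exact: x0max.
exact: (no_interior_max oU su (fun x v Ux => convex_second su cu v Ux) sl Ux0 Uy K1 kap0
  nM h0 far hmax).
Qed.

End Doubling.

Theorem proposition4p1 (R : realType) (n : nat) (hn : (0 < n)%N) :
  exists (Rad : R -> R) (C1 : R -> R -> R) (C2 : R -> R -> R -> R),
  forall (Theta : R) (u : 'rV[R]_n -> R),
    - (n%:R * (pi / 2)) < Theta -> Theta < n%:R * (pi / 2) ->
    smooth_on (eball 0 2) u ->
    convex_function (eball 0 2) u ->
    special_lagrangian (eball 0 2) Theta u ->
    let N : R := fine (C01_norm (eball 0 1) u) in
    forall y : 'rV[R]_n, eball 0 (1 / 2) y ->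
      0 < Rad N /\
      eball y (Rad N) `<=` eball 0 2 /\
      forall r : R, 0 < r -> r <= Rad N ->
        (sup_on (eball y (Rad N)) (fun x => slag_a (hessian u x))
           <= (C1 r N)%:E * sup_on (eball y r) (fun x => slag_a (hessian u x)))%E
        /\
        (sup_on (eball y (Rad N)) (fun x => mxnorm (hessian u x))
           <= (C2 r N (fine (sup_on (eball y r)
                               (fun x => mxnorm (hessian u x)))))%:E)%E.
Proof.
exists (fun N => (twist_slope n N)^-1), (doubling_const n),
  (fun r N S => doubling_const n r N * (1 + S ^+ 2) ^+ n).
move=> Theta u _ _ su cu sl N y yB.
have [N0 gradN] := gradient_bound hn su cu.
rewrite -/N in N0 gradN.
have L0 : 0 <= twist_bound n N by rewrite mulr_ge0 // sqr_ge0.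
have K4 : 4 <= twist_slope n N by rewrite /twist_slope; lra.
have K0 : 0 < twist_slope n N by lra.
set Rad := (twist_slope n N)^-1.
have R4 : Rad <= 4^-1 by rewrite lef_pV2 ?posrE.
have R0 : 0 < Rad by rewrite invr_gt0.
have ballU t : t <= Rad -> cball y t `<=` eball 0 2.
  by move=> tR; apply: cball_sub_eball yB _; lra.
split=> //; split; first by move=> x /eball_sub_cball; exact: ballU.
case: n hn u su cu sl N y yB N0 gradN L0 K4 K0 @Rad R4 R0 ballU => // n _ u su cu sl N y yB N0
  gradN L0 K4 K0 Rad R4 R0 ballU r r0 rR.
have [c1 [x1 x1B dbl]] := slag_V_doubling su cu sl N0 gradN yB r0 rR.
set c := doubling_const n.+1 r N in c1 dbl *.
have oU : open (eball (0 : 'rV[R]_n.+1) 2) by exact: eball_open.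
have bounds x : cball y Rad x -> [/\ 1 <= slag_V (hessian u x),
    mxnorm (hessian u x) <= slag_V (hessian u x) &
    slag_V (hessian u x) <= (1 + mxnorm (hessian u x) ^+ 2) ^+ n.+1].
  move=> /(ballU _ (lexx _)) Ux; have [lam [eA _]] := sl x Ux.
  exact: slag_V_bounds (hessian_sym oU su Ux) eA.
have x1c : cball y r x1 by exact: eball_sub_cball.
have x1R : cball y Rad x1 by exact: le_trans x1c rR.
have [_ _ Vle1] := bounds x1 x1R.
have c0 : 0 <= c by lra.
split.
  apply: sup_on_le => x xB; have [Vx _ _] := bounds x (eball_sub_cball xB).
  apply: (@le_trans _ _ (c%:E * (slag_a (hessian u x1))%:E)%E); last first.
    by apply: lee_wpmul2l; [rewrite lee_fin | exact: sup_on_ub].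
  rewrite -EFinM lee_fin /slag_a.
  have p0 : 0 <= n.+1%:R^-1 :> R by rewrite invr_ge0.
  apply: (@le_trans _ _ ((c * slag_V (hessian u x1)) `^ n.+1%:R^-1)).
    have vn : slag_V (hessian u x) \is Num.nneg by rewrite nnegrE sqrtr_ge0.
    have cn : c * slag_V (hessian u x1) \is Num.nneg.
      by rewrite nnegrE (mulr_ge0 c0 (sqrtr_ge0 _)).
    exact: (ge0_ler_powR p0 vn cn (dbl x xB)).
  rewrite (powRM _ c0 (sqrtr_ge0 _)).
  apply: ler_wpM2r; first exact: powR_ge0.
  rewrite -[leRHS](powRr1 c0); apply: ler_powR => //.
  by rewrite invf_le1 ?ltr0n // ler1n.
apply: sup_on_le => x xB; rewrite lee_fin.
have [_ Mx _] := bounds x (eball_sub_cball xB).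
apply: (le_trans Mx); apply: (le_trans (dbl x xB)); apply: ler_wpM2l => //.
apply: (le_trans Vle1).
set S := fine _.
have MS : mxnorm (hessian u x1) <= S.
  have [|G G0 GP] := @cball_bounded _ _ (fun x => mxnorm (hessian u x)) y r (ltW r0).
    by move=> z /(ballU _ rR); exact: mxnorm_hessian_continuous su.
  rewrite -lee_fin fineK; first exact: sup_on_ub.
  apply: (sup_on_fin (G := G) x1B) => z zB.
  exact: le_trans (ler_norm _) (GP z (eball_sub_cball zB)).
have M0 := mxnorm_ge0 (hessian u x1).
have S0 : 0 <= S by exact: le_trans MS.
have sq : mxnorm (hessian u x1) ^+ 2 <= S ^+ 2.
  by apply: lerXn2r MS; rewrite nnegrE.
apply: lerXn2r; rewrite ?nnegrE ?addr_ge0 ?sqr_ge0 //.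
by rewrite lerD2l.
Qed.
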